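(* Let $C \subset \mathbb{P}^2$ be an integral plane curve over $\mathbb{C}$ with normalization $\pi: \tilde C \to C$, let $P$ be a double point of $C$, and let $m\ge 1$ be an integer. Then: (1) $P$ is an $A_{2m-1}$ singularity of $C$ if and only if all of the following hold: (a) $\pi^{-1}(P) = \{Q_1, Q_2\}$ (set-theoretically, with $Q_1\neq Q_2$); (b) $\pi (mQ_1|_{\tilde C}\cup mQ_2|_{\tilde C})= X$, where $X$ is a curvilinear scheme of length $m$ contained in $C$; (c) $m$ is the maximum integer for which (b) holds. (2) $P$ is an $A_{2m}$ singularity of $C$ if and only if all of the following hold: (a) $\pi^{-1}(P) = \{Q\}$ (set-theoretically, a single point); (b) $\pi (2mQ|_{\tilde C}) = X$, where $X$ is a curvilinear scheme of length $m$ contained in $C$; (c) $m$ is the maximum integer for which (b) holds.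
   Context: The ground field is $\mathbb{C}$. A double point of $C$ is a point of multiplicity exactly $2$. A singularity of type $A_s$ of a plane curve ($s\ge 1$) is a double point which, writing $s=2r-\varepsilon$ with $\varepsilon\in\{0,1\}$, can be resolved via $r$ blow-ups and whose desingularization yields two points over it if $\varepsilon=1$ and only one if $\varepsilon=0$ (equivalently, the curve at the point is analytically isomorphic to $y^2-x^{s+1}=0$ at the origin). For a curve $D$ smooth at a point $Q$, $mQ|_D$ denotes the curvilinear $0$-dimensional scheme of length $m$ supported at $Q$ and contained in $D$ (defined by the $m$-th power of the maximal ideal of $\mathcal{O}_{D,Q}$). A $0$-dimensional scheme supported at a point is curvilinear if it is contained in a curve smooth at that point. For a $0$-dimensional subscheme $Y\subset\tilde C$, $\pi(Y)$ is the scheme-theoretic image of $Y$ in $C$. *)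

(* Defs.v *)
From HB Require Import structures.
From mathcomp Require Import all_boot all_order all_algebra.
From mathcomp Require Import mpoly complex classical_sets reals.

Set Implicit Arguments.
Unset Strict Implicit.
Unset Printing Implicit Defensive.

Import GRing.Theory.
Local Open Scope classical_set_scope.
Local Open Scope ring_scope.

(* An integral plane curve C is given by an irreducible form F in three       *)
(* variables. Every notion below is local at a point P of C, and is expressed *)
(* in a standard affine chart of P^2 containing P, with P moved to the origin.*)
(* Closed subschemes of the chart A^2 are represented by their ideals in      *)
(* K[x,y] = {mpoly K[2]}, given as sets.                                      *)

Definition mpoly_irreducible (n : nat) (K : fieldType) (F : {mpoly K[n]}) :=
  [/\ F != 0, F \isn't a GRing.unit
    & forall G H : {mpoly K[n]}, F = G * H ->
        (G \is a GRing.unit) \/ (H \is a GRing.unit)].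

(* Equation of {F = 0} in the chart {X_j != 0} containing [p], the point      *)
(* (x, y) of the chart being [p + x e_k + y e_l] where k < l are the indices  *)
(* other than j. This is the usual chart, with coordinates X_k/X_j, X_l/X_j,  *)
(* up to a translation and the scaling by p_j.                                *)
Definition affine_chart (K : fieldType) (F : {mpoly K[3]})
    (p : 'I_3 -> K) (j : 'I_3) : {mpoly K[2]} :=
  F \mPo [tuple (p k)%:MP_[2] + (if unlift j k is Some l then 'X_l else 0) | k < 3].

Section PlaneGerms.
Variable K : fieldType.
Implicit Types (f g : {mpoly K[2]}) (I : set {mpoly K[2]}).

(* The curve f = 0 has multiplicity mu at the origin; it misses the origin    *)
(* when mu = 0 and it is smooth there when mu = 1.                            *)
Definition has_mult f (mu : nat) :=
  (exists2 a, a \in msupp f & mdeg a = mu) /\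
  (forall a, a \in msupp f -> (mu <= mdeg a)%N).

Local Notation X := ('X_ord0 : {mpoly K[2]}).
Local Notation Y := ('X_ord_max : {mpoly K[2]}).

(* Blow-up of the plane at the origin, seen around the point of the           *)
(* exceptional line with direction dir: [Some t] is the direction (1 : t),    *)
(* with blow-down (x, y) |-> (x, x (y + t)), and [None] is (0 : 1), with      *)
(* blow-down (x, y) |-> (x y, y). The new point is again the origin.          *)
Definition blow_down (dir : option K) : 2.-tuple {mpoly K[2]} :=
  if dir is Some t then [tuple X; X * (Y + t%:MP)] else [tuple X * Y; Y].

Definition exceptional (dir : option K) : {mpoly K[2]} :=
  if dir is Some _ then X else Y.

Definition strict_transform f (dir : option K) f' :=
  exists2 mu, has_mult f mu & f \mPo blow_down dir = exceptional dir ^+ mu * f'.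

(* [resolved_by r f]: the singularity of f = 0 at the origin is resolved by r *)
(* point blow-ups, each of them centred at a singular point of the successive *)
(* strict transforms. When the origin is singular, it is blown up and then    *)
(* [n dir] blow-ups are needed at the point with direction dir, this being    *)
(* nonzero only for dir in the finite set D.                                  *)
Inductive resolved_by : nat -> {mpoly K[2]} -> Prop :=
| resolved_smooth f mu :
    has_mult f mu -> (mu <= 1)%N -> resolved_by 0 f
| resolved_blow_up f mu (D : seq (option K)) (n : option K -> nat)
    (f' : option K -> {mpoly K[2]}) :
    has_mult f mu -> (1 < mu)%N ->
    uniq D -> (forall dir, dir \notin D -> n dir = 0%N) ->
    (forall dir, strict_transform f dir (f' dir)) ->
    (forall dir, resolved_by (n dir) (f' dir)) ->
    resolved_by (\sum_(dir <- D) n dir).+1 f.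

Definition has_length I (m : nat) :=
  exists e : 'I_m -> {mpoly K[2]}, forall g,
    exists! c : 'rV[K]_m, I (g - \sum_i c 0 i *: e i).

(* For a scheme supported at the origin. *)
Definition curvilinear I := exists2 g, I g & has_mult g 1.

Definition curvilinear_in f I (m : nat) :=
  [/\ I f, has_length I m & curvilinear I].

End PlaneGerms.

Section Normalization.
Variables (K L : fieldType) (phi : {rmorphism {mpoly K[2]} -> L}).
Implicit Types (Q J : set L).

(* phi exhibits L as a field of fractions of the coordinate ring K[x,y]/(f).  *)
Definition is_function_field (f : {mpoly K[2]}) :=
  (forall g, phi g = 0 <-> exists h, g = h * f) /\
  (forall u : L, exists a b, phi b != 0 /\ u = phi a / phi b).

(* The coordinate ring of the normalization over the chart.                   *)
Definition normalization : set L := [set u | integralOver phi u].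

Definition is_ideal J :=
  [/\ J `<=` normalization, J 0,
      forall u v, J u -> J v -> J (u + v)
    & forall a u, normalization a -> J u -> J (a * u)].

Definition is_maximal_ideal Q :=
  [/\ is_ideal Q, Q <> normalization
    & forall J, is_ideal J -> Q `<=` J -> J = Q \/ J = normalization].

Definition ideal_mul J1 J2 : set L :=
  [set u | exists s : seq (L * L),
     (forall v, v \in s -> J1 v.1 /\ J2 v.2) /\ u = \sum_(v <- s) v.1 * v.2].

(* [ideal_exp Q m] is the ideal of the divisor m Q on the normalization.      *)
Fixpoint ideal_exp Q (m : nat) : set L :=
  if m is m'.+1 then ideal_mul Q (ideal_exp Q m') else normalization.

(* The points of the normalization over the origin, as maximal ideals.        *)
Definition fibre : set (set L) :=
  [set Q | is_maximal_ideal Q /\ phi @^-1` Q = [set g | g.@[fun=> 0] = 0]].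

(* Ideal, in the plane, of the scheme-theoretic image of the closed subscheme *)
(* of the normalization with ideal J.                                         *)
Definition scheme_image J : set {mpoly K[2]} := phi @^-1` J.

(* The origin is an A_s singularity of f = 0, where L is the function field.  *)
Definition A_singularity (f : {mpoly K[2]}) (s : nat) :=
  has_mult f 2 /\
  exists (r : nat) (eps : bool),
    [/\ s = (2 * r - eps)%N, resolved_by r f
      & if eps then exists Q1 Q2, Q1 <> Q2 /\ fibre = [set Q1; Q2]
        else exists Q, fibre = [set Q]].

End Normalization.

(* Main.v *)
Require Import Defs.
From HB Require Import structures.
From mathcomp Require Import all_boot all_order all_algebra.
From mathcomp Require Import mpoly complex classical_sets reals.
From mathcomp Require Import boolp ring zify.

(** Since the kernel of [phi] is generated by [f] and [L] is a field, [f] is a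
    prime of K[x,y].

    The theorem follows from a third description of the integer [m], the order of
    contact of the curve with smooth germs: [contact k f] says that [f] lies in the
    square of the ideal (g) + m^k, for some smooth germ g and the maximal ideal m of
    the origin. For a double point this holds for k = 1, and it fails for large k
    because the eliminant of [f] and its derivative in y is not zero
    ([contact_bounded]). Let r be the last order of contact.

    On the side of blow-ups, the tangent cone of a double point is either a pair of
    lines, and one blow-up resolves the point, or a double line. In the second case
    the only point of the strict transform that can be singular lies in the double
    direction, and passing to it lowers the order of contact by exactly one. So the
    point is resolved by r blow-ups ([contact_resolved_by]), and by no other number
    of them ([resolved_by_inj]).

    On the side of the normalization, choose coordinates in which y^2 occurs in the
    tangent cone. Contact of order r is then contact with a graph, that is
    f = c g^2 + b x^r g + a x^(2 r) with g = y - h(x) and c not zero at the origin.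
    The quotient w = g / x^r is the coordinate of the last strict transform on the
    exceptional line; it satisfies c w^2 + b w + a = 0. Let B be the local ring of
    the curve at the origin with w adjoined. Its quotient by x has the basis 1, w
    ([branch_free]). By maximality of r the polynomial c(0) w^2 + b(0) w + a(0) has
    two distinct roots, or else a double root at which the strict transform is
    smooth ([maximal_normal_form]). In both cases B contains the normalization, and
    coincides with it up to functions that do not vanish at the origin. The fibre
    of the normalization consists of the roots, and x B is the product of the two
    maximal ideals in the first case, the square of the only one in the second.
    Hence the ideals of the theorem are the functions on the plane that are
    divisible by x^k in B ([two_branches_image], [one_branch_image]). For k <= r
    this ideal is (g, x^k), which is curvilinear of length k; for k > r it contains
    no equation of a smooth germ, by freeness ([curvilinear_filtration]). So the
    largest k in the theorem is r, the number of blow-ups, and the number of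
    points of the fibre is the same on both sides of the equivalences. *)

Set Implicit Arguments.
Unset Strict Implicit.
Unset Printing Implicit Defensive.

Import GRing.Theory.
Local Open Scope classical_set_scope.
Local Open Scope ring_scope.

(** * Order of vanishing at the origin *)

Section OrderOfVanishing.
Variable K : fieldType.
Local Notation A := {mpoly K[2]}.
Local Notation X := ('X_ord0 : A).
Local Notation Y := ('X_ord_max : A).
Implicit Types f g u v : A.

Lemma lift_ord0_ord2 : lift ord0 ord0 = ord_max :> 'I_2.
Proof. exact: val_inj. Qed.

Lemma mpoly2_ind (P : A -> Prop) :
    (forall c, P c%:MP) -> P X -> P Y ->
    (forall u v, P u -> P v -> P (u + v)) ->
    (forall u v, P u -> P v -> P (u * v)) ->
  forall f, P f.
Proof.
move=> PC PX PY PD PM.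
have PE u n : P u -> P (u ^+ n).
  by move=> Pu; elim: n => [|n IH]; rewrite ?exprS; [exact: (PC 1) | exact: PM].
elim/mpolyind => [|c m f _ _ Pf]; first exact: (PC 0).
apply: (PD) => //; rewrite -mul_mpolyC mpolyXE_id big_ord_recl big_ord1.
apply: (PM) => //; apply: (PM); first exact: PE.
by rewrite lift_ord0_ord2; exact: PE.
Qed.

(** The k-th power of the maximal ideal of the origin. The recursive form turns
    stability under products, substitutions and blow-downs into short inductions. *)
Fixpoint order_ge (k : nat) f : Prop :=
  if k is k'.+1 then
    exists u v, [/\ f = X * u + Y * v, order_ge k' u & order_ge k' v]
  else True.

Arguments order_ge : simpl never.

Lemma order_ge_0 k : order_ge k 0.
Proof. by elim: k => //= k IH; exists 0, 0; split=> //; ring. Qed.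

Lemma order_geD k u v : order_ge k u -> order_ge k v -> order_ge k (u + v).
Proof.
elim: k u v => //= k IH u v [u1 [u2 [-> h1 h2]]] [v1 [v2 [-> h3 h4]]].
by exists (u1 + v1), (u2 + v2); split; [ring | exact: IH | exact: IH].
Qed.

Lemma order_geMr k u v : order_ge k u -> order_ge k (u * v).
Proof.
elim: k u => //= k IH u [u1 [u2 [-> h1 h2]]].
by exists (u1 * v), (u2 * v); split; [ring | exact: IH | exact: IH].
Qed.

Lemma order_geMl k u v : order_ge k v -> order_ge k (u * v).
Proof. by rewrite mulrC; exact: order_geMr. Qed.

Lemma order_geW k l f : (l <= k)%N -> order_ge k f -> order_ge l f.
Proof.
elim: k l f => [|k IH] [|l] f //= lk [u [v [-> hu hv]]].
by exists u, v; split=> //; exact: IH.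
Qed.

Lemma order_geM k l u v : order_ge k u -> order_ge l v -> order_ge (k + l) (u * v).
Proof.
elim: k u => [|k IH] u /=; first by move=> _; exact: order_geMl.
case=> u1 [u2 [-> h1 h2]] hv.
by exists (u1 * v), (u2 * v); split; [ring | exact: IH | exact: IH].
Qed.

Lemma order_geX : order_ge 1 X.
Proof. by exists 1, 0; split=> //; ring. Qed.

Lemma order_geY : order_ge 1 Y.
Proof. by exists 0, 1; split=> //; ring. Qed.

Lemma order_ge_exp u k : order_ge 1 u -> order_ge k (u ^+ k).
Proof.
by move=> h; elim: k => // k IH; rewrite exprS -add1n; exact: order_geM.
Qed.

Lemma order_ge_msupp k f a : order_ge k f -> a \in msupp f -> (k <= mdeg a)%N.
Proof.
elim: k f a => // k IH f a [u [v [-> hu hv]]].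
have mon i w : order_ge k w -> a \in msupp ('X_i * w) -> (k < mdeg a)%N.
  move=> hw; rewrite mulrC (perm_mem (msuppMX _ _)) => /mapP [b hb ->].
  by rewrite mdegD mdeg1 add1n ltnS; exact: IH hb.
move/msuppD_le; rewrite mem_cat => /orP [] ha; [exact: mon ha | exact: mon ha].
Qed.

Lemma order_ge_coef k f a : order_ge k f -> (mdeg a < k)%N -> f@_a = 0.
Proof.
move=> hf ak; apply/eqP; rewrite mcoeff_eq0; apply/negP => /(order_ge_msupp hf).
by rewrite leqNgt ak.
Qed.

Lemma msupp_order_ge k f :
  (forall a, a \in msupp f -> (k <= mdeg a)%N) -> order_ge k f.
Proof.
move=> hf; rewrite [f]mpolyE; move: hf.
elim: (msupp f) => [|a s IH] hs; first by rewrite big_nil; exact: order_ge_0.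
rewrite big_cons; apply: order_geD; last by apply: IH => b bs; apply: hs; rewrite inE bs orbT.
rewrite -mul_mpolyC; apply: order_geMl.
apply: (@order_geW (mdeg a)); first by apply: hs; rewrite inE eqxx.
rewrite mdegE mpolyXE_id !big_ord_recl !big_ord0 mulr1 addn0.
apply: order_geM; apply: order_ge_exp; first exact: order_geX.
by rewrite lift_ord0_ord2; exact: order_geY.
Qed.

Lemma has_multE f mu : has_mult f mu <-> order_ge mu f /\ ~ order_ge mu.+1 f.
Proof.
split=> [[[a ha am] hf]|[hf hn]].
  split; first exact: msupp_order_ge.
  by move=> /order_ge_msupp /(_ ha); rewrite am ltnn.
split; last by move=> a; exact: order_ge_msupp.
apply: contrapT => hne; apply: hn; apply: msupp_order_ge => a ha.
rewrite ltn_neqAle (order_ge_msupp hf ha) andbT; apply/eqP => eqm.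
by apply: hne; exists a.
Qed.

End OrderOfVanishing.

Arguments order_ge : simpl never.
Arguments order_geX {K}.
Arguments order_geY {K}.
Arguments order_ge_0 {K} k.

(** * Local expansions and blow-downs *)

Section LocalExpansion.
Variable K : fieldType.
Local Notation A := {mpoly K[2]}.
Local Notation X := ('X_ord0 : A).
Local Notation Y := ('X_ord_max : A).
Implicit Types f g u v : A.

Lemma comp_XE a b : X \mPo [tuple a; b] = a :> A.
Proof. by rewrite comp_mpolyXU. Qed.

Lemma comp_YE a b : Y \mPo [tuple a; b] = b :> A.
Proof. by rewrite comp_mpolyXU. Qed.

Lemma comp_mpolyM (l : 2.-tuple A) f g : (f * g) \mPo l = (f \mPo l) * (g \mPo l).
Proof. exact: rmorphM. Qed.

Lemma comp_mpolyXn (l : 2.-tuple A) f k : (f ^+ k) \mPo l = (f \mPo l) ^+ k.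
Proof. exact: rmorphXn. Qed.

Lemma comp_mpoly_const (l : 2.-tuple A) c : c%:MP \mPo l = c%:MP :> A.
Proof. exact: comp_mpolyC. Qed.

Definition comp_simp :=
  (@comp_mpolyD, @comp_mpolyN, comp_mpolyM, comp_mpolyXn, comp_mpoly_const).

Lemma order_ge_comp a b k f :
  order_ge 1 a -> order_ge 1 b -> order_ge k f -> order_ge k (f \mPo [tuple a; b]).
Proof.
move=> ha hb; elim: k f => // k IH f [u [v [-> hu hv]]].
rewrite !comp_simp /= comp_XE comp_YE; apply: order_geD.
  by rewrite -add1n; apply: order_geM => //; exact: IH.
by rewrite -add1n; apply: order_geM => //; exact: IH.
Qed.

Lemma meval_order_ge1 f : order_ge 1 f -> f.@[fun=> 0] = 0.
Proof. by case=> a [b [-> _ _]]; rewrite mevalD !mevalM !mevalXU; ring. Qed.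

Lemma const_term f : exists r, f = (f.@[fun=> 0])%:MP + r /\ order_ge 1 r.
Proof.
suff [c [r [-> hr]]] : exists c r, f = c%:MP + r /\ order_ge 1 r.
  by exists r; rewrite mevalD mevalC (meval_order_ge1 hr) addr0.
elim/mpoly2_ind: f => [c|||u v [c [r [-> hr]]] [d [s [-> hs]]]
                      |u v [c [r [-> hr]]] [d [s [-> hs]]]].
- by exists c, 0; rewrite addr0; split=> //; exact: order_ge_0.
- by exists 0, X; rewrite mpolyC0 add0r; split=> //; exact: order_geX.
- by exists 0, Y; rewrite mpolyC0 add0r; split=> //; exact: order_geY.
- exists (c + d), (r + s); rewrite mpolyCD; split; [ring | exact: order_geD].
- exists (c * d), (c%:MP * s + r * (d%:MP + s)); rewrite mpolyCM; split; first ring.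
  by apply: order_geD; [exact: order_geMl | exact: order_geMr].
Qed.

Lemma order_ge1E f : order_ge 1 f <-> f.@[fun=> 0] = 0.
Proof.
split; first exact: meval_order_ge1.
by have [r [df hr]] := const_term f => e; rewrite df e mpolyC0 add0r.
Qed.

Lemma linear_part f : order_ge 1 f ->
  exists al be r, f = al%:MP * X + be%:MP * Y + r /\ order_ge 2 r.
Proof.
case=> u [v [-> _ _]].
have [r [du hr]] := const_term u; have [s [dv hs]] := const_term v.
exists (u.@[fun=> 0]), (v.@[fun=> 0]), (X * r + Y * s).
split; first by rewrite {1}du {1}dv; ring.
by exists r, s.
Qed.

Lemma quadratic_part f : order_ge 2 f ->
  exists a b c r,
    f = a%:MP * X ^+ 2 + b%:MP * X * Y + c%:MP * Y ^+ 2 + r /\ order_ge 3 r.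
Proof.
case=> u [v [-> hu hv]].
have [a [b [r [-> hr]]]] := linear_part hu.
have [a' [b' [s [-> hs]]]] := linear_part hv.
exists a, (b + a'), b', (X * r + Y * s); split; first by rewrite mpolyCD; ring.
by exists r, s.
Qed.

Lemma order_ge_monomial c i k : order_ge k.+1 (c%:MP * 'X_i ^+ k : A) -> c = 0.
Proof.
move/order_ge_coef => /(_ (U_(i) *+ k)%MM).
by rewrite mdegMn mdeg1 mul1n leqnn mcoeffCM mcoeffXn eqxx mulr1; apply.
Qed.

Lemma mpolyXU_neq0 i : 'X_i != 0 :> A.
Proof.
apply/eqP => e; have := @order_ge_monomial 1 i 1; rewrite expr1 e mulr0.
by move=> /(_ (order_ge_0 _)) /eqP; rewrite oner_eq0.
Qed.

Lemma linear_part_eq0 al be r :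
  order_ge 2 (al%:MP * X + be%:MP * Y + r : A) -> order_ge 2 r ->
  al = 0 /\ be = 0.
Proof.
move=> h hr.
have {}h : order_ge 2 (al%:MP * X + be%:MP * Y).
  have -> : al%:MP * X + be%:MP * Y = (al%:MP * X + be%:MP * Y + r) + (-1) * r by ring.
  by apply: order_geD => //; exact: order_geMl.
split; apply: (@order_ge_monomial _ _ 1); rewrite expr1.
  have := order_ge_comp order_geX (order_ge_0 1) h.
  by rewrite !comp_simp /= comp_XE comp_YE mulr0 addr0; apply.
have := order_ge_comp (order_ge_0 1) order_geY h.
by rewrite !comp_simp /= comp_XE comp_YE mulr0 add0r; apply.
Qed.

Lemma quadratic_part_eq0 a b c r :
    order_ge 3 (a%:MP * X ^+ 2 + b%:MP * X * Y + c%:MP * Y ^+ 2 + r : A) ->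
    order_ge 3 r ->
  [/\ a = 0, b = 0 & c = 0].
Proof.
move=> h hr.
have {}h : order_ge 3 (a%:MP * X ^+ 2 + b%:MP * X * Y + c%:MP * Y ^+ 2).
  have -> : a%:MP * X ^+ 2 + b%:MP * X * Y + c%:MP * Y ^+ 2 =
    (a%:MP * X ^+ 2 + b%:MP * X * Y + c%:MP * Y ^+ 2 + r) + (-1) * r by ring.
  by apply: order_geD => //; exact: order_geMl.
have a0 : a = 0.
  apply: (@order_ge_monomial _ ord0 2).
  have := order_ge_comp order_geX (order_ge_0 1) h.
  by rewrite !comp_simp /= comp_XE comp_YE expr0n /= !mulr0 !addr0; apply.
have c0 : c = 0.
  apply: (@order_ge_monomial _ ord_max 2).
  have := order_ge_comp (order_ge_0 1) order_geY h.
  by rewrite !comp_simp /= comp_XE comp_YE expr0n /= !mulr0 !mul0r !add0r; apply.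
split=> //; apply: (@order_ge_monomial _ ord0 2).
have := order_ge_comp order_geX order_geX h.
by rewrite !comp_simp /= comp_XE comp_YE a0 c0 mpolyC0 !mul0r add0r addr0 -mulrA; apply.
Qed.

Lemma order_ge_blow_down k f dir : order_ge k f ->
  exists f', f \mPo blow_down dir = exceptional dir ^+ k * f'.
Proof.
elim: k f => [|k IH] f; first by exists (f \mPo blow_down dir); rewrite mul1r.
case=> u [v [-> /IH [u' hu] /IH [v' hv]]].
rewrite !comp_simp hu hv; case: dir {IH hu hv} => [t|] /=; rewrite comp_XE comp_YE.
  by exists (u' + (Y + t%:MP) * v'); rewrite exprS; ring.
by exists (X * u' + v'); rewrite exprS; ring.
Qed.

Lemma strict_transform_quadratic_Some t a b c r f' : order_ge 3 r ->
    (a%:MP * X ^+ 2 + b%:MP * X * Y + c%:MP * Y ^+ 2 + r) \mPo blow_down (Some t)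
      = X ^+ 2 * f' ->
  exists r', f' = (a + b * t + c * t ^+ 2)%:MP
     + (b + c * t *+ 2)%:MP * Y + c%:MP * Y ^+ 2 + X * r'.
Proof.
case/(order_ge_blow_down (Some t)) => r'; rewrite !comp_simp => -> /=.
rewrite comp_XE comp_YE => e; exists r'.
have nX : X ^+ 2 != 0 :> A by apply/expf_neq0/mpolyXU_neq0.
apply: (mulfI nX); rewrite -e !(mpolyCD, mpolyCM, rmorphXn, mpolyCMn) /=.
ring.
Qed.

Lemma strict_transform_quadratic_None a b c r f' : order_ge 3 r ->
    (a%:MP * X ^+ 2 + b%:MP * X * Y + c%:MP * Y ^+ 2 + r) \mPo blow_down None
      = Y ^+ 2 * f' ->
  exists r', f' = c%:MP + b%:MP * X + a%:MP * X ^+ 2 + Y * r'.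
Proof.
case/(order_ge_blow_down None) => r'; rewrite !comp_simp => -> /=.
rewrite comp_XE comp_YE => e; exists r'.
have nY : Y ^+ 2 != 0 :> A by apply/expf_neq0/mpolyXU_neq0.
by apply: (mulfI nY); rewrite -e; ring.
Qed.

End LocalExpansion.

(** * Uniqueness of the number of blow-ups *)

Section ResolvedUnique.
Variable K : fieldType.
Local Notation A := {mpoly K[2]}.
Implicit Types f g : A.

Lemma has_mult_inj f mu mu' : has_mult f mu -> has_mult f mu' -> mu = mu'.
Proof.
move=> [[a ha <-] hmu] [[b hb <-] hmu'].
by apply/eqP; rewrite eqn_leq hmu // hmu'.
Qed.

Lemma exceptional_neq0 dir : exceptional dir != 0 :> A.
Proof. by case: dir => [t|]; exact: mpolyXU_neq0. Qed.

Lemma strict_transform_inj f dir f1 f2 :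
  strict_transform f dir f1 -> strict_transform f dir f2 -> f1 = f2.
Proof.
move=> [mu hmu e1] [mu' hmu' e2].
rewrite -(has_mult_inj hmu hmu') {}e1 in e2.
exact: (mulfI (expf_neq0 mu (exceptional_neq0 dir)) e2).
Qed.

Lemma sumn_support_eq (T : eqType) (n : T -> nat) (D D' : seq T) :
    uniq D -> uniq D' -> (forall t, t \notin D -> n t = 0%N) ->
    (forall t, t \notin D' -> n t = 0%N) ->
  (\sum_(t <- D) n t = \sum_(t <- D') n t)%N.
Proof.
move=> uD uD' nD nD'.
have red s : (\sum_(t <- s) n t = \sum_(t <- [seq t <- s | n t != 0]) n t)%N.
  rewrite big_filter [RHS]big_mkcond; apply: eq_bigr => t _.
  by case: eqP.
rewrite red [RHS]red; apply: perm_big; apply: uniq_perm; rewrite ?filter_uniq //.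
move=> t; rewrite !mem_filter; case: eqP => //= nt.
have [tD|/nD //] := boolP (t \in D).
by have [tD'|/nD' //] := boolP (t \in D').
Qed.

Lemma resolved_by_inv r f : resolved_by r f ->
  (r = 0%N /\ exists2 mu, has_mult f mu & (mu <= 1)%N) \/
  exists mu (D : seq (option K)) (n : option K -> nat) (f' : option K -> A),
    [/\ has_mult f mu, (1 < mu)%N,
        uniq D /\ (forall dir, dir \notin D -> n dir = 0%N),
        (forall dir, strict_transform f dir (f' dir)) /\
        (forall dir, resolved_by (n dir) (f' dir))
      & r = (\sum_(dir <- D) n dir).+1].
Proof.
case=> [g mu hmu mu1|g mu D n f' hmu mu1 uD nD hf' hr].
  by left; split=> //; exists mu.
by right; exists mu, D, n, f'.
Qed.

(** A curve determines its strict transforms, hence the count in each direction;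
    two lists of directions can only differ by directions that count for zero. *)
Lemma resolved_by_inj r r' f : resolved_by r f -> resolved_by r' f -> r = r'.
Proof.
move=> h; elim: h r' => {r f} [f mu hmu mu1|f mu D n f' hmu mu1 uD nD hf' _ IH] r'.
  case/resolved_by_inv => [[->]//|[nu [D [n [f' [hnu nu1 _ _ _]]]]]].
  by move: nu1; rewrite -(has_mult_inj hmu hnu) ltnNge mu1.
case/resolved_by_inv => [[_ [nu hnu nu1]]|].
  by move: mu1; rewrite (has_mult_inj hmu hnu) ltnNge nu1.
move=> [nu [D' [n' [g' [_ _ [uD' nD'] [hg' hr] ->]]]]].
have nE dir : n dir = n' dir.
  by apply: IH; rewrite (strict_transform_inj (hf' dir) (hg' dir)).
rewrite (eq_bigr n') => [|t _]; last exact: nE.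
by congr _.+1; apply: sumn_support_eq => // t /nD; rewrite nE.
Qed.

End ResolvedUnique.

(** * Expansions along a graph *)

Section NormalForm.
Variable K : fieldType.
Local Notation A := {mpoly K[2]}.
Local Notation X := ('X_ord0 : A).
Local Notation Y := ('X_ord_max : A).
Implicit Types (f g u v : A) (h p q : {poly K}).

(** The inclusion of K[x] in K[x,y]. *)
Definition xpoly p : A := (map_poly (@mpolyC 2 K) p).[X].

Lemma xpolyC c : xpoly c%:P = c%:MP.
Proof. by rewrite /xpoly map_polyC hornerC. Qed.

Lemma xpoly0 : xpoly 0 = 0.
Proof. by rewrite xpolyC mpolyC0. Qed.

Lemma xpolyX : xpoly 'X = X.
Proof. by rewrite /xpoly map_polyX hornerX. Qed.

Lemma xpolyD p q : xpoly (p + q) = xpoly p + xpoly q.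
Proof. by rewrite /xpoly rmorphD hornerD. Qed.

Lemma xpolyM p q : xpoly (p * q) = xpoly p * xpoly q.
Proof. by rewrite /xpoly rmorphM hornerM. Qed.

Lemma xpolyXn k : xpoly 'X^k = X ^+ k.
Proof.
elim: k => [|k IH]; first by rewrite !expr0 (xpolyC 1).
by rewrite !exprS xpolyM xpolyX IH.
Qed.

Definition xpolyE := (xpolyD, xpolyM, xpolyXn, xpolyX, xpolyC).

Lemma meval_xpoly p : (xpoly p).@[fun=> 0] = p.[0].
Proof.
elim/poly_ind: p => [|p c IH]; first by rewrite xpoly0 meval0 horner0.
by rewrite !xpolyE mevalD mevalM mevalXU mevalC !hornerE.
Qed.

(** Restriction to the curve y = h(x), parametrized by x. *)
Definition on_graph h f : {poly K} :=
  mmap (@polyC K) (tnth [tuple 'X; h]) f.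

Lemma on_graphC h c : on_graph h c%:MP = c%:P.
Proof. exact: mmapC. Qed.

Lemma on_graphX h : on_graph h X = 'X.
Proof. by rewrite /on_graph mmapX mmap1U. Qed.

Lemma on_graphY h : on_graph h Y = h.
Proof. by rewrite /on_graph mmapX mmap1U. Qed.

Lemma on_graphD h u v : on_graph h (u + v) = on_graph h u + on_graph h v.
Proof. by rewrite /on_graph rmorphD. Qed.

Lemma on_graphM h u v : on_graph h (u * v) = on_graph h u * on_graph h v.
Proof. by rewrite /on_graph rmorphM. Qed.

Lemma on_graphXn h u k : on_graph h (u ^+ k) = on_graph h u ^+ k.
Proof. by rewrite /on_graph rmorphXn. Qed.

Lemma on_graphN h u : on_graph h (- u) = - on_graph h u.
Proof. by rewrite /on_graph rmorphN. Qed.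

Definition on_graphE :=
  (on_graphD, on_graphN, on_graphM, on_graphXn, on_graphX, on_graphY, on_graphC).

Lemma on_graph_xpoly h p : on_graph h (xpoly p) = p.
Proof.
elim/poly_ind: p => [|p c IH]; first by rewrite xpoly0 -(mpolyC0) on_graphC.
by rewrite !xpolyE !on_graphE IH.
Qed.

Lemma on_graph_remainder h f :
  exists f1, f = xpoly (on_graph h f) + (Y - xpoly h) * f1.
Proof.
elim/mpoly2_ind: f => [c|||u v [u1 du] [v1 dv]|u v [u1 du] [v1 dv]].
- by exists 0; rewrite on_graphC xpolyC; ring.
- by exists 0; rewrite on_graphX xpolyX; ring.
- by exists 1; rewrite on_graphY; ring.
- by exists (u1 + v1); rewrite {1}du {1}dv on_graphD xpolyD; ring.
- exists (u1 * v + xpoly (on_graph h u) * v1).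
  rewrite on_graphM xpolyM; move: (xpoly _) (xpoly (on_graph h v)) du dv => U V -> ->.
  ring.
Qed.

Lemma poly_factorX p : p.[0] = 0 -> exists q, p = 'X * q.
Proof.
move=> /eqP p0; have /factor_theorem [q ->] : root p 0 by [].
by exists q; rewrite subr0 mulrC.
Qed.

(** Since h vanishes at the origin, x and y - h generate the maximal ideal; only
    the monomials of degree at most one in y - h are kept apart. *)
Lemma on_graph_order_ge n h u : h.[0] = 0 -> order_ge n.+1 u ->
  exists a b c, u = X ^+ n.+1 * a + X ^+ n * (Y - xpoly h) * b + (Y - xpoly h) ^+ 2 * c.
Proof.
case/poly_factorX => h1 dh.
have dY : Y = (Y - xpoly h) + X * xpoly h1 by rewrite dh xpolyM xpolyX; ring.
move: (Y - xpoly h) dY => G dY.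
elim: n u => [|n IH] u [v [w [-> hv hw]]].
  by exists (v + xpoly h1 * w), w, 0; rewrite dY; ring.
have [a [b [c ->]]] := IH _ hv; have [a' [b' [c' ->]]] := IH _ hw.
exists (a + xpoly h1 * a'), (b + xpoly h1 * b' + a').
exists (X * c + Y * c' + X ^+ n * b').
by rewrite dY !exprS; ring.
Qed.

(** Expansions in powers of y - h with coefficients in K[x] are unique: restrict
    to the graph, cancel y - h, restrict again. *)
Lemma on_graph_eq0 h p q u :
    xpoly p + (Y - xpoly h) * xpoly q + (Y - xpoly h) ^+ 2 * u = 0 ->
  p = 0 /\ q = 0.
Proof.
move=> e; have r0 : on_graph h 0 = 0 by rewrite -mpolyC0 on_graphC.
have p0 : p = 0.
  by have := congr1 (on_graph h) e; rewrite !on_graphE !on_graph_xpoly ?r0 ?polyC0 => <-; ring.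
split=> //; move: e; rewrite p0 xpoly0 add0r expr2 -mulrA -mulrDr => /eqP.
rewrite mulf_eq0 => /orP [/eqP e|/eqP e].
  have /eqP := congr1 (on_graph (h + 1)) e.
  rewrite !on_graphE on_graph_xpoly ?r0 ?polyC0 addrAC subrr add0r.
  by rewrite oner_eq0.
by have := congr1 (on_graph h) e; rewrite !on_graphE !on_graph_xpoly ?r0 ?polyC0 => <-; ring.
Qed.

(** This says that [f] lies in the square of the ideal (y - h, x^k). *)
Definition normal_form k h f :=
  exists (a b : {poly K}) (c : A),
    f = c * (Y - xpoly h) ^+ 2 + xpoly b * X ^+ k * (Y - xpoly h)
        + xpoly a * X ^+ (2 * k).

(** Replace [a] and [b] by their restrictions to the graph: the remainders are
    multiples of y - h, and the next coefficient absorbs them. *)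
Lemma normalize_coefs k h a b c f : h.[0] = 0 -> (0 < k)%N ->
    f = c * (Y - xpoly h) ^+ 2 + b * X ^+ k * (Y - xpoly h) + a * X ^+ (2 * k) ->
  exists (a' b' : {poly K}) (c' : A),
    [/\ f = c' * (Y - xpoly h) ^+ 2 + xpoly b' * X ^+ k * (Y - xpoly h)
          + xpoly a' * X ^+ (2 * k),
        a'.[0] = a.@[fun=> 0] & b'.[0] = b.@[fun=> 0]].
Proof.
move=> h0 k0 ->.
have e0 u : (on_graph h u).[0] = u.@[fun=> 0].
  have [u1 du] := on_graph_remainder h u.
  by rewrite {2}du mevalD mevalM mevalB mevalXU !meval_xpoly h0 subrr mul0r addr0.
have [a1 da] := on_graph_remainder h a.
have [b1 db] := on_graph_remainder h (b + X ^+ k * a1).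
exists (on_graph h a), (on_graph h (b + X ^+ k * a1)), (c + X ^+ k * b1).
rewrite !e0 mevalD mevalM rmorphXn /= mevalXU expr0n eqn0Ngt k0 mul0r addr0; split=> //.
move: (xpoly (on_graph h (b + _))) (xpoly (on_graph h a)) da db => B A' -> db.
have -> : b = B + (Y - xpoly h) * b1 - X ^+ k * a1 by rewrite -db; ring.
by rewrite mul2n -addnn exprD; ring.
Qed.

End NormalForm.

(** * Contact with smooth germs *)

Section Contact.
Variable K : fieldType.
Local Notation A := {mpoly K[2]}.
Local Notation X := ('X_ord0 : A).
Local Notation Y := ('X_ord_max : A).
Implicit Types (f g u v : A) (h p q : {poly K}).

Lemma xpolyN p : xpoly (- p) = - xpoly p :> A.
Proof. by apply/eqP; rewrite -subr_eq0 opprK -xpolyD addNr xpoly0. Qed.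

Lemma xpolyXnM k p : xpoly ('X^k * p) = X ^+ k * xpoly p.
Proof. by rewrite (xpolyM 'X^k p) xpolyXn. Qed.

(** [f] lies in the square of the ideal generated by a smooth germ [g] and the
    k-th power of the maximal ideal. No coordinates are involved, so that the notion
    survives exchanges and shears of the coordinates. *)
Definition contact (k : nat) f :=
  exists g a b c, [/\ has_mult g 1, order_ge k b, order_ge (2 * k) c
                    & f = a * g ^+ 2 + b * g + c].

Lemma comp_comp f a b (l : 2.-tuple A) :
  (f \mPo [tuple a; b]) \mPo l = f \mPo [tuple a \mPo l; b \mPo l].
Proof.
elim/mpoly2_ind: f => [c|||u v hu hv|u v hu hv]; rewrite ?comp_mpolyC //.
- by rewrite !comp_XE.
- by rewrite !comp_YE.
- by rewrite !comp_mpolyD hu hv.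
- by rewrite !rmorphM /= hu hv.
Qed.

Lemma comp_id f : f \mPo [tuple X; Y] = f.
Proof.
elim/mpoly2_ind: f => [c|||u v hu hv|u v hu hv]; rewrite ?comp_mpolyC //.
- by rewrite !comp_XE.
- by rewrite !comp_YE.
- by rewrite !comp_mpolyD hu hv.
- by rewrite !rmorphM /= hu hv.
Qed.

Lemma has_mult_comp a b a' b' mu f : order_ge 1 a -> order_ge 1 b ->
    order_ge 1 a' -> order_ge 1 b' ->
    a \mPo [tuple a'; b'] = X -> b \mPo [tuple a'; b'] = Y ->
  has_mult f mu -> has_mult (f \mPo [tuple a; b]) mu.
Proof.
move=> ha hb ha' hb' ea eb /has_multE [h1 h2]; apply/has_multE.
split; first exact: order_ge_comp.
by move/(order_ge_comp ha' hb'); rewrite comp_comp ea eb comp_id.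
Qed.

Lemma contact_comp a b a' b' k f : order_ge 1 a -> order_ge 1 b ->
    order_ge 1 a' -> order_ge 1 b' ->
    a \mPo [tuple a'; b'] = X -> b \mPo [tuple a'; b'] = Y ->
  contact k f -> contact k (f \mPo [tuple a; b]).
Proof.
move=> ha hb ha' hb' ea eb [g [u [v [w [hg hv hw ->]]]]].
exists (g \mPo [tuple a; b]), (u \mPo [tuple a; b]), (v \mPo [tuple a; b]),
  (w \mPo [tuple a; b]).
split; [exact: has_mult_comp ea eb hg | exact: order_ge_comp | exact: order_ge_comp|].
by rewrite !comp_simp.
Qed.

Lemma contact1 f : order_ge 2 f -> contact 1 f.
Proof.
move=> hf; exists Y, 0, 0, f; split; [|exact: order_ge_0|exact: hf|ring].
apply/has_multE; split; first exact: order_geY.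
move=> h; have := @order_ge_monomial K 1 ord_max 1; rewrite expr1 mul1r => /(_ h) /eqP.
by rewrite oner_eq0.
Qed.

Lemma contact_order_ge k f : contact k.+1 f -> order_ge 2 f.
Proof.
move=> [g [a [b [c [/has_multE [hg _] hb hc ->]]]]].
apply: order_geD; last by apply: order_geW hc; rewrite mulnS.
apply: order_geD; first by apply: order_geMl; apply: (@order_geM _ 1 1).
by apply: (@order_geM _ 1 1) => //; apply: order_geW hb.
Qed.

Lemma has_mult_linear g : has_mult g 1 ->
  exists al be s, [/\ g = al%:MP * X + be%:MP * Y + s, order_ge 2 s
                    & al = 0 -> be <> 0].
Proof.
move=> /has_multE [/linear_part [al [be [s [-> hs]]]] hn].
exists al, be, s; split=> // al0 be0; apply: hn.
by rewrite al0 be0 mpolyC0 !mul0r !add0r.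
Qed.

Lemma order_ge_linear al be : order_ge 1 (al%:MP * X + be%:MP * Y : A).
Proof.
by apply: order_geD; apply: order_geMl; [exact: order_geX | exact: order_geY].
Qed.

Lemma linear_has_mult al be s : order_ge 2 s -> (al = 0 -> be <> 0) ->
  has_mult (al%:MP * X + be%:MP * Y + s) 1.
Proof.
move=> hs h; apply/has_multE; split.
  by apply: order_geD; [exact: order_ge_linear | exact: order_geW hs].
by move=> /linear_part_eq0 /(_ hs) [/h].
Qed.

Lemma graph_has_mult h : h.[0] = 0 -> has_mult (Y - xpoly h) 1.
Proof.
case/poly_factorX => h1 ->; rewrite xpolyM xpolyX.
have [r [-> hr]] := const_term (xpoly h1); set c := (xpoly h1).@[_].
have -> : Y - X * (c%:MP + r) = (- c)%:MP * X + 1%:MP * Y + (- 1) * (X * r).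
  by rewrite mpolyCN mpolyC1; ring.
apply: linear_has_mult; last by move=> _; apply/eqP/oner_neq0.
by apply: order_geMl; apply: (@order_geM _ 1 1) => //; exact: order_geX.
Qed.

Lemma normal_form_contact k h f : h.[0] = 0 -> normal_form k h f -> contact k f.
Proof.
move=> h0 [a [b [c ->]]].
exists (Y - xpoly h), c, (xpoly b * X ^+ k), (xpoly a * X ^+ (2 * k)).
split; [exact: graph_has_mult | | |ring]; apply: order_geMl;
  apply: order_ge_exp; exact: order_geX.
Qed.

Lemma on_graph_blow_down h (t : K) f :
  on_graph h (f \mPo blow_down (Some t)) = on_graph ('X * (h + t%:P)) f.
Proof.
elim/mpoly2_ind: f => [c|||u v hu hv|u v hu hv].
- by rewrite comp_mpolyC !on_graphE.
- by rewrite /= comp_XE !on_graphE.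
- by rewrite /= comp_YE !on_graphE.
- by rewrite comp_mpolyD !on_graphD hu hv.
- by rewrite rmorphM /= !on_graphM hu hv.
Qed.

(** A power series solution, truncated. The induction blows up the direction
    tangent to the germ: the coefficient of y is the same for the strict transform,
    and a graph y = h'(x) upstairs becomes y = x (h'(x) + t) downstairs. *)
Lemma implicit_function al be s : order_ge 2 s -> be != 0 -> forall k,
  exists h q, h.[0] = 0 /\ on_graph h (al%:MP * X + be%:MP * Y + s) = 'X^k * q.
Proof.
move=> hs nb k; elim: k al s hs => [|k IH] al s hs.
  by exists 0; eexists; rewrite horner0 expr0 mul1r.
pose g := al%:MP * X + be%:MP * Y + s; rewrite -/g; pose t := - al / be.
have [s' ds] := order_ge_blow_down (Some t) hs.
have [r [dr hr]] := const_term s'; move: (s'.@[_]) dr => m0 dr.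
have [|h' [q [h'0 hq]]] := IH m0 (X * r).
  by apply: (@order_geM _ 1 1) => //; exact: order_geX.
exists ('X * (h' + t%:P)), q; split; first by rewrite !hornerE.
rewrite exprS -mulrA -hq -{1}[Z in Z * on_graph _ _](on_graphX h') -on_graphM.
rewrite -on_graph_blow_down; congr (on_graph _ _).
rewrite /g [(_ + s) \mPo _]comp_mpolyD ds !comp_simp /= comp_XE comp_YE dr.
have -> : al = - be * t by rewrite /t; field.
by rewrite mpolyCM mpolyCN; ring.
Qed.

(** Contact of order at least two makes the tangent cone a double line: it is a
    multiple of the square of the linear part of the germ. *)
Lemma square_quadratic k al be s a b c : order_ge 2 s -> order_ge k.+2 b ->
    order_ge (2 * k.+2) c ->
  exists a0 r,
    a * (al%:MP * X + be%:MP * Y + s) ^+ 2 + b * (al%:MP * X + be%:MP * Y + s) + c =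
    (a0 * al ^+ 2)%:MP * X ^+ 2 + (a0 * al * be *+ 2)%:MP * X * Y
      + (a0 * be ^+ 2)%:MP * Y ^+ 2 + r /\ order_ge 3 r.
Proof.
move=> hs hb hc; have [a1 [da ha1]] := const_term a.
have hl := order_ge_linear al be.
set l := al%:MP * X + be%:MP * Y in hl *.
exists (a.@[fun=> 0]), (a1 * (l * l) + a * (s * (l + l + s)) + b * (l + s) + c).
split.
  rewrite {1}da mulrDl -!addrA; set m0 := a.@[_].
  rewrite !(mpolyCM, mpolyCMn, rmorphXn) /= [in RHS]da -/m0 /l; ring.
apply: order_geD; last by apply: order_geW hc; rewrite !mulnS.
apply: order_geD; last first.
  apply: (@order_geM _ 2 1); first exact: order_geW hb.
  by apply: order_geD => //; exact: order_geW hs.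
apply: order_geD.
  by apply: (@order_geM _ 1 2) => //; apply: (@order_geM _ 1 1).
apply: order_geMl; apply: (@order_geM _ 2 1) => //.
by apply: order_geD; [exact: order_geD | exact: order_geW hs].
Qed.

(** As y^2 occurs in the tangent cone, the tangent of the germ is not vertical, so
    that the germ is a graph up to any order. In contact of order one the germ
    can be taken to be y. *)
Lemma contact_normal_form k f a b c r : c != 0 ->
    f = a%:MP * X ^+ 2 + b%:MP * X * Y + c%:MP * Y ^+ 2 + r -> order_ge 3 r ->
    contact k.+1 f ->
  exists h, h.[0] = 0 /\ normal_form k.+1 h f.
Proof.
move=> nc df hr; case: k => [|k] hf.
  have hf2 := contact_order_ge hf; exists 0; split; first exact: horner0.
  have [a' [b' [c' e]]] := on_graph_order_ge (horner0 0) hf2.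
  have [|a2 [b2 [c2 [e2 _ _]]]] := @normalize_coefs _ 1 0 a' b' c' f (horner0 0) isT.
    by rewrite e; ring.
  by exists a2, b2, c2.
have [g [u [v [w [hg hv hw e]]]]] := hf.
have [al [be [s [dg hs _]]]] := has_mult_linear hg.
have nbe : be != 0.
  apply/eqP => be0; have [a0 [r' [e' hr']]] := square_quadratic al be u hs hv hw.
  rewrite -dg -e be0 df in e'.
  have := @quadratic_part_eq0 _ (a - a0 * al ^+ 2) (b - a0 * al * 0 *+ 2) (c - a0 * 0 ^+ 2) (r - r').
  have hrr : order_ge 3 (r - r').
    by apply: order_geD => //; rewrite -mulN1r; exact: order_geMl.
  case=> //; last by move=> _ _; rewrite expr0n mulr0 subr0; apply/eqP.
  set z := (Z in order_ge 3 Z).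
  suff -> : z = 0 by exact: order_ge_0.
  rewrite /z !mpolyCB; move/eqP: e'; rewrite -subr_eq0 => /eqP <-; ring.
have [h [q [h0 hq]]] := implicit_function al hs nbe k.+2.
rewrite -dg in hq; exists h; split=> //.
have [g1 dg1] := on_graph_remainder h g.
rewrite hq xpolyM xpolyXn in dg1.
have [b1 [b2 [b3 db]]] := on_graph_order_ge h0 hv.
have ek : (2 * k.+2 = (k.+1 + k.+2).+1)%N by lia.
rewrite ek in hw; have [c1 [c2 [c3 dc]]] := on_graph_order_ge h0 hw.
have e2 : exists a' b' c', f = c' * (Y - xpoly h) ^+ 2 + b' * X ^+ k.+2 * (Y - xpoly h)
    + a' * X ^+ (2 * k.+2).
  rewrite e dg1 db dc ek !(exprD, exprS).
  move: (Y - xpoly h) (xpoly q) (X ^+ k) => G Q Z.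
  exists (u * Q ^+ 2 + b1 * Q + c1).
  exists (u * Q * g1 *+ 2 + b1 * g1 + Z * b2 * Q * X + Z * c2 * X).
  exists (u * g1 ^+ 2 + X * Z * b2 * g1 + b3 * (X * X * Z * Q + G * g1) + c3).
  ring.
have [a' [b' [c' e3]]] := e2.
have [a4 [b4 [c4 [e4 _ _]]]] := normalize_coefs h0 (isT : 0 < k.+2)%N e3.
by exists a4, b4, c4.
Qed.

Lemma xpoly_blow_down (t : K) p : xpoly p \mPo blow_down (Some t) = xpoly p.
Proof.
elim/poly_ind: p => [|p c IH]; first by rewrite xpoly0 comp_mpoly0.
by rewrite !xpolyE !comp_simp /= comp_XE IH.
Qed.

(** Compare the expansion of [f] along the graph of x (h' + t) with that of its
    strict transform along the graph of h'; both are unique. *)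
Lemma normal_form_blow_down j h' (t : K) f f' :
    f \mPo blow_down (Some t) = X ^+ 2 * f' ->
    h'.[0] = 0 -> normal_form j h' f' ->
  normal_form j.+1 ('X * (h' + t%:P)) f.
Proof.
move=> e h'0 [a [b [c df']]]; set h := 'X * _.
have [f1 df] := on_graph_remainder h f.
have [f2 df1] := on_graph_remainder h f1.
move: (on_graph h f) (on_graph h f1) df df1 => P Q df df1.
have eG : (Y - xpoly h) \mPo blow_down (Some t) = X * (Y - xpoly h').
  rewrite !comp_simp xpoly_blow_down /= comp_YE /h xpolyM xpolyD xpolyX xpolyC; ring.
have nX : X != 0 by exact: mpolyXU_neq0.
have := @on_graph_eq0 _ h' (P - 'X^(2 + 2 * j) * a) ('X * Q - 'X^(2 + j) * b)
  (X ^+ 2 * (f2 \mPo blow_down (Some t)) - X ^+ 2 * c).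
case.
  rewrite df df1 comp_mpolyD comp_mpolyM eG comp_mpolyD comp_mpolyM eG in e.
  rewrite !xpoly_blow_down df' in e.
  rewrite !xpolyD !xpolyN !xpolyXnM xpolyM xpolyX.
  move/eqP: e; rewrite -subr_eq0 => /eqP <-; rewrite !exprD; ring.
move/eqP; rewrite subr_eq0 => /eqP dP /eqP; rewrite subr_eq0 => /eqP dQ.
have {}dQ : Q = 'X^(j.+1) * b.
  by apply: (mulfI (_ : 'X != 0)); rewrite ?polyX_eq0 // dQ mulrA -exprS.
exists a, b, f2; rewrite df df1 dP dQ !xpolyXnM mulnS; ring.
Qed.

End Contact.

(** * Tangent directions of a double point *)

Section DoublePoints.
Variable K : fieldType.
Local Notation A := {mpoly K[2]}.
Local Notation X := ('X_ord0 : A).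
Local Notation Y := ('X_ord_max : A).
Implicit Types (f g u v r : A) (h : {poly K}) (a b c t p : K).

Local Notation quadric a b c :=
  (a%:MP * X ^+ 2 + b%:MP * X * Y + c%:MP * Y ^+ 2).

(** A multiple root of the binary form a x^2 + b x y + c y^2. *)
Definition double_direction a b c (dir : option K) :=
  if dir is Some t then a + b * t + c * t ^+ 2 = 0 /\ b + c * t *+ 2 = 0
  else c = 0 /\ b = 0.

Lemma double_direction_inj a b c dir dir' : [|| a != 0, b != 0 | c != 0] ->
  double_direction a b c dir -> double_direction a b c dir' -> dir = dir'.
Proof.
have nSome t0 : [|| a != 0, b != 0 | c != 0] ->
    double_direction a b c (Some t0) -> double_direction a b c None -> False.
  move=> nz [e _] [c0 b0]; move: e nz; rewrite c0 b0 !mul0r !addr0 => ->.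
  by rewrite eqxx.
move=> nz; case: dir dir' => [t|] [t'|] // h h'; [|by case: (nSome t nz)|by case: (nSome t' nz)].
case: h h' => [e1 e2] [e3 e4]; congr Some; apply/eqP; rewrite -subr_eq0.
have c0 : c != 0.
  apply/eqP => c0; move: nz e1 e2; rewrite c0 !mul0r ?mul0rn !addr0 => nz e1 e2.
  by move: nz e1; rewrite e2 ?mul0r ?addr0 => nz e1; move: nz; rewrite e1 eqxx.
have : c * (t - t') ^+ 2 == 0.
  have -> : c * (t - t') ^+ 2 = (a + b * t' + c * t' ^+ 2) - (a + b * t + c * t ^+ 2)
     + (b + c * t *+ 2) * (t - t') by ring.
  by rewrite e1 e2 e3 subrr mul0r addr0.
by rewrite mulf_eq0 (negbTE c0) expf_eq0.
Qed.

Lemma quadric_neq0 a b c r : order_ge 3 r -> ~ order_ge 3 (quadric a b c + r) ->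
  [|| a != 0, b != 0 | c != 0].
Proof.
move=> hr; apply: contra_notT; rewrite !negb_or !negbK => /and3P [/eqP-> /eqP-> /eqP->].
by rewrite !mpolyC0 !mul0r !add0r.
Qed.

(** Local behaviour of a curve on the exceptional line E = 0, where Z is the
    coordinate: substituting zero for E, which is what [l] does, leaves a
    polynomial in Z whose coefficients decide. *)
Lemma exceptional_expansion Z E (l : A * A) p0 p1 p2 u :
    order_ge 1 l.1 -> order_ge 1 l.2 -> order_ge 1 E ->
    Z \mPo [tuple l.1; l.2] = Z -> E \mPo [tuple l.1; l.2] = 0 ->
    (exists i, Z = 'X_i) ->
    let f := p0%:MP + p1%:MP * Z + p2%:MP * Z ^+ 2 + E * u in
  [/\ ~ (p0 = 0 /\ p1 = 0) -> exists2 mu, has_mult f mu & (mu <= 1)%N,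
      p0 = 0 -> order_ge 1 f
    & p0 = 0 -> p1 = 0 -> order_ge 3 f -> p2 = 0].
Proof.
case: l => l1 l2 /= hl1 hl2 hE eZ eE [i dZ].
set f := _ + _ + _ + _.
have hZ : order_ge 1 Z by apply/order_ge1E; rewrite dZ mevalXU.
have ef : f.@[fun=> 0] = p0.
  move/order_ge1E: hZ => hZ; move/order_ge1E: hE => hE.
  by rewrite !mevalD !mevalM !mevalC hZ hE; ring.
have el k : order_ge k f -> order_ge k (p0%:MP + p1%:MP * Z + p2%:MP * Z ^+ 2).
  by move/(order_ge_comp hl1 hl2); rewrite !comp_simp eZ eE mul0r addr0.
split=> [np|p00|p00 p10 /el].
- have [p00|np0] := eqVneq p0 0; last first.
    by exists 0%N => //; apply/has_multE; split=> // /order_ge1E; rewrite ef; apply/eqP.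
  exists 1%N => //; apply/has_multE; split; first by apply/order_ge1E; rewrite ef.
  move/el => h; apply: np; split=> //; apply: (@order_ge_monomial _ _ i 1).
  rewrite expr1 -dZ.
  have -> : p1%:MP * Z = (p0%:MP + p1%:MP * Z + p2%:MP * Z ^+ 2) + (- p2%:MP) * (Z * Z).
    by rewrite p00 mpolyC0; ring.
  by apply: order_geD => //; apply: order_geMl; exact: (@order_geM _ 1 1).
- by apply/order_ge1E; rewrite ef.
- rewrite p00 p10 mpolyC0 mul0r !add0r dZ; exact: order_ge_monomial.
Qed.

Lemma exceptional_expansion_Some p0 p1 p2 u :
    let f := p0%:MP + p1%:MP * Y + p2%:MP * Y ^+ 2 + X * u in
  [/\ ~ (p0 = 0 /\ p1 = 0) -> exists2 mu, has_mult f mu & (mu <= 1)%N,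
      p0 = 0 -> order_ge 1 f
    & p0 = 0 -> p1 = 0 -> order_ge 3 f -> p2 = 0].
Proof.
apply: (@exceptional_expansion _ _ (0, Y)); rewrite /= ?comp_XE ?comp_YE //.
- exact: order_ge_0.
- exact: order_geY.
- exact: order_geX.
- by exists ord_max.
Qed.

Lemma exceptional_expansion_None p0 p1 p2 u :
    let f := p0%:MP + p1%:MP * X + p2%:MP * X ^+ 2 + Y * u in
  [/\ ~ (p0 = 0 /\ p1 = 0) -> exists2 mu, has_mult f mu & (mu <= 1)%N,
      p0 = 0 -> order_ge 1 f
    & p0 = 0 -> p1 = 0 -> order_ge 3 f -> p2 = 0].
Proof.
apply: (@exceptional_expansion _ _ (X, 0)); rewrite /= ?comp_XE ?comp_YE //.
- exact: order_geX.
- exact: order_ge_0.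
- exact: order_geY.
- by exists ord0.
Qed.

(** The strict transform meets the exceptional line at the roots of the tangent
    cone, and transversally at a simple root. *)
Lemma simple_direction a b c r dir f' : order_ge 3 r ->
    (quadric a b c + r) \mPo blow_down dir = exceptional dir ^+ 2 * f' ->
    ~ double_direction a b c dir ->
  exists2 mu, has_mult f' mu & (mu <= 1)%N.
Proof.
case: dir => [t|] hr e.
  have [r' ->] := strict_transform_quadratic_Some hr e.
  by have [h _ _] := exceptional_expansion_Some (a + b * t + c * t ^+ 2)
    (b + c * t *+ 2) c r'.
have [r' ->] := strict_transform_quadratic_None hr e.
by have [h _ _] := exceptional_expansion_None c b a r'.
Qed.

(** On the exceptional line the strict transform is a nonzero multiple of the
    square of the coordinate. *)
Lemma double_direction_order a b c r dir f' : order_ge 3 r ->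
    [|| a != 0, b != 0 | c != 0] ->
    (quadric a b c + r) \mPo blow_down dir = exceptional dir ^+ 2 * f' ->
    double_direction a b c dir ->
  order_ge 1 f' /\ ~ order_ge 3 f'.
Proof.
move=> hr nz; case: dir => [t|] e [d0 d1].
  have [r' ->] := strict_transform_quadratic_Some hr e.
  have [_ h1 h3] := exceptional_expansion_Some (a + b * t + c * t ^+ 2)
    (b + c * t *+ 2) c r'.
  split; [exact: h1 | move=> /(h3 d0 d1) c0; move: d0 d1 nz].
  by rewrite c0 !mul0r ?mul0rn !addr0 => + b0; rewrite b0 mul0r addr0 => ->; rewrite eqxx.
have [r' ->] := strict_transform_quadratic_None hr e.
have [_ h1 h3] := exceptional_expansion_None c b a r'.
split; [exact: h1 | move=> /(h3 d0 d1) a0; move: nz].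
by rewrite a0 d0 d1 eqxx.
Qed.

End DoublePoints.

(** * Contact and resolution *)

Section ResolutionByContact.
Variable K : fieldType.
Local Notation A := {mpoly K[2]}.
Local Notation X := ('X_ord0 : A).
Local Notation Y := ('X_ord_max : A).
Implicit Types (f g u v r : A) (h : {poly K}) (a b c t : K).

Local Notation quadric a b c :=
  (a%:MP * X ^+ 2 + b%:MP * X * Y + c%:MP * Y ^+ 2).

Lemma quadric_inj a b c r a' b' c' r' : order_ge 3 r -> order_ge 3 r' ->
    quadric a b c + r = quadric a' b' c' + r' -> [/\ a = a', b = b' & c = c'].
Proof.
move=> hr hr' e.
have hrr : order_ge 3 (r - r').
  by apply: order_geD => //; rewrite -mulN1r; exact: order_geMl.
case: (@quadratic_part_eq0 _ (a - a') (b - b') (c - c') (r - r')) => //.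
  set z := (Z in order_ge 3 Z).
  suff -> : z = 0 by exact: order_ge_0.
  by rewrite /z !mpolyCB; move/eqP: e; rewrite -subr_eq0 => /eqP <-; ring.
by move=> /eqP + /eqP + /eqP; rewrite !subr_eq0 => /eqP -> /eqP -> /eqP ->.
Qed.

Lemma has_mult1_le g mu : order_ge 1 g -> has_mult g mu -> (mu <= 1)%N ->
  has_mult g 1.
Proof.
move=> h1 hmu; case: mu hmu => [|[|mu]] // /has_multE [_ h].
by case: h.
Qed.

(** The germ [g] is tangent to the double direction, so it lifts to a smooth germ.
    In f = a g^2 + b g + c, division by the square of the exceptional equation
    takes one such factor from b and two from c. *)
Lemma contact_strict_transform k a b c r dir f' : order_ge 3 r ->
    [|| a != 0, b != 0 | c != 0] ->
    (quadric a b c + r) \mPo blow_down dir = exceptional dir ^+ 2 * f' ->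
    double_direction a b c dir -> contact k.+2 (quadric a b c + r) ->
  contact k.+1 f'.
Proof.
move=> hr nz e dd [g [u [v [w [hg hv hw ef]]]]].
suff [g' [eg hg']] : exists g', g \mPo blow_down dir = exceptional dir * g' /\ has_mult g' 1.
  have [v' ev] := order_ge_blow_down dir hv.
  have [w' ew] := order_ge_blow_down dir hw.
  exists g', (u \mPo blow_down dir), (exceptional dir ^+ k.+1 * v'),
    (exceptional dir ^+ (2 * k.+1) * w').
  have hE : order_ge 1 (exceptional dir).
    by case: dir {e dd eg ev ew} => [t|]; [exact: order_geX | exact: order_geY].
  split=> //; try by apply: order_geMr; exact: order_ge_exp.
  apply: (mulfI (expf_neq0 2 (exceptional_neq0 dir))).
  rewrite -e ef !comp_simp eg ev ew !mul2n -!addnn !addSn !addnS !exprS; ring.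
have [al [be [s [dg hs nal]]]] := has_mult_linear hg.
have [a0 [r2 [e2 hr2]]] := square_quadratic al be u hs hv hw.
rewrite -dg -ef in e2; have [ea eb ec] := quadric_inj hr hr2 e2.
have na0 : a0 != 0.
  by apply/eqP => a00; move: nz; rewrite ea eb ec a00 !mul0r mul0rn eqxx.
case: dir e dd => [t|] _ /= [d0 d1].
  have et : al + be * t = 0.
    have : a0 * (al + be * t) ^+ 2 == 0.
      by rewrite -d0 ea eb ec; apply/eqP; ring.
    by rewrite mulf_eq0 (negbTE na0) expf_eq0 /= => /eqP.
  have [s' es] := order_ge_blow_down (Some t) hs.
  have [np h1 _] := exceptional_expansion_Some 0 be 0 s'.
  have [|mu hmu mu1] := np.
    by case=> _ be0; apply: nal => //; move: et; rewrite be0 mul0r addr0.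
  eexists; split; last exact: (has_mult1_le (h1 erefl) hmu mu1).
  rewrite dg [(_ + s) \mPo _]comp_mpolyD es !comp_simp /= comp_XE comp_YE.
  have -> : al = - (be * t) by apply/eqP; rewrite -addr_eq0 et.
  by rewrite mpolyCN mpolyCM mpolyC0; ring.
have be0 : be = 0.
  by move/eqP: d0; rewrite ec mulf_eq0 (negbTE na0) expf_eq0 /= => /eqP.
have [s' es] := order_ge_blow_down None hs.
have [np h1 _] := exceptional_expansion_None 0 al 0 s'.
have [|mu hmu mu1] := np; first by case=> _ al0; exact: nal.
eexists; split; last exact: (has_mult1_le (h1 erefl) hmu mu1).
rewrite dg [(_ + s) \mPo _]comp_mpolyD es !comp_simp /= comp_XE comp_YE be0.
by rewrite mpolyC0; ring.
Qed.

(** In the chart of a finite direction the strict transform keeps y^2 in its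
    tangent cone; its contact is therefore given by a graph, which blows down. *)
Lemma contact_of_strict_transform_Some k a b c r t f' : order_ge 3 r ->
    [|| a != 0, b != 0 | c != 0] ->
    (quadric a b c + r) \mPo blow_down (Some t) = X ^+ 2 * f' ->
    double_direction a b c (Some t) -> contact k.+1 f' ->
  contact k.+2 (quadric a b c + r).
Proof.
move=> hr nz e [d0 d1] hf'.
have nc : c != 0.
  apply/eqP => c0; move: nz d0 d1; rewrite c0 !mul0r ?mul0rn !addr0 => + + b0.
  by rewrite b0 mul0r addr0 => + a0; rewrite a0 eqxx.
have [r' ef'] := strict_transform_quadratic_Some hr e.
have [a1 [b1 [c1 [r1 [e1 hr1]]]]] := quadratic_part (contact_order_ge hf').
have ec : c - c1 = 0.
  apply: (@order_ge_monomial _ _ ord_max 2).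
  have := order_ge_comp (order_ge_0 1) order_geY hr1.
  move: e1; rewrite ef' d0 d1 => /(congr1 (comp_mpoly [tuple 0; Y])).
  rewrite !comp_simp !comp_XE !comp_YE => e1.
  set z := r1 \mPo _ in e1 *; suff -> : z = (c - c1)%:MP * Y ^+ 2 by [].
  rewrite mpolyCB mulrBl; apply/eqP; rewrite eq_sym subr_eq; apply/eqP.
  by move: e1; rewrite !mpolyC0 => e1; ring: e1.
move/eqP: ec; rewrite subr_eq0 => /eqP ec; rewrite ec in nc.
have [h [h0 nf]] := contact_normal_form nc e1 hr1 hf'.
apply: normal_form_contact (normal_form_blow_down e h0 nf).
by rewrite !hornerE.
Qed.

Lemma contact_of_strict_transform k a b c r dir f' : order_ge 3 r ->
    [|| a != 0, b != 0 | c != 0] ->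
    (quadric a b c + r) \mPo blow_down dir = exceptional dir ^+ 2 * f' ->
    double_direction a b c dir -> contact k.+1 f' ->
  contact k.+2 (quadric a b c + r).
Proof.
case: dir => [t|] hr nz e dd hf'; first exact: contact_of_strict_transform_Some e dd hf'.
(* Exchanging the coordinates turns the direction [None] into [Some 0]. *)
have swap k0 f0 : contact k0 f0 -> contact k0 (f0 \mPo [tuple Y; X]).
  apply: (@contact_comp _ Y X Y X); rewrite ?comp_XE ?comp_YE //;
    by [exact: order_geX | exact: order_geY].
have swapK f0 : (f0 \mPo [tuple Y; X]) \mPo [tuple Y; X] = f0.
  by rewrite comp_comp comp_XE comp_YE comp_id.
rewrite -[_ + r]swapK; apply: (swap).
have -> : (quadric a b c + r) \mPo [tuple Y; X] = quadric c b a + (r \mPo [tuple Y; X]).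
  rewrite !comp_simp comp_XE comp_YE; ring.
case: dd => c0 b0.
apply: (@contact_of_strict_transform_Some _ _ _ _ _ 0 (f' \mPo [tuple Y; X])).
- by apply: order_ge_comp => //; [exact: order_geY | exact: order_geX].
- by move: nz; rewrite c0 b0 eqxx /= orbF.
- have := congr1 (comp_mpoly [tuple Y; X]) e.
  rewrite /= mpolyC0 addr0 !comp_simp !comp_comp !comp_simp !comp_XE !comp_YE.
  rewrite [Y * X]mulrC => <-; ring.
- by rewrite /= c0 b0; split; ring.
- exact: swap.
Qed.

Lemma contact_double_direction k a b c r : order_ge 3 r ->
    contact k.+2 (quadric a b c + r) -> exists dir, double_direction a b c dir.
Proof.
move=> hr [g [u [v [w [hg hv hw ef]]]]].
have [al [be [s [dg hs nal]]]] := has_mult_linear hg.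
have [a0 [r2 [e2 hr2]]] := square_quadratic al be u hs hv hw.
rewrite -dg -ef in e2; have [-> -> ->] := quadric_inj hr hr2 e2.
have [->|nbe] := eqVneq be 0.
  by exists None; rewrite /=; split; ring.
by exists (Some (- al / be)) => /=; split; field.
Qed.

Lemma resolved_by_simple f : has_mult f 2 ->
    (forall dir, exists f', f \mPo blow_down dir = exceptional dir ^+ 2 * f' /\
       exists2 mu, has_mult f' mu & (mu <= 1)%N) ->
  resolved_by 1 f.
Proof.
move=> hf /choice [f' hf'].
have -> : 1%N = (\sum_(dir <- [::] : seq (option K)) 0).+1 by rewrite big_nil.
apply: (@resolved_blow_up _ f 2 [::] (fun=> 0%N) f') => // dir.
  by have [e _] := hf' dir; exists 2%N.
by have [_ [mu hmu mu1]] := hf' dir; exact: resolved_smooth hmu mu1.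
Qed.

Lemma resolved_by_double f n d0 f0 : has_mult f 2 ->
    strict_transform f d0 f0 -> resolved_by n f0 ->
    (forall dir, dir != d0 ->
       exists f', f \mPo blow_down dir = exceptional dir ^+ 2 * f' /\
         exists2 mu, has_mult f' mu & (mu <= 1)%N) ->
  resolved_by n.+1 f.
Proof.
move=> hf hf0 rf0 hs.
have /choice [f' hf'] : forall dir, exists f', strict_transform f dir f' /\
    resolved_by (if dir == d0 then n else 0%N) f'.
  move=> dir; case: eqVneq => [->|/hs [f' [e [mu hmu mu1]]]]; first by exists f0.
  by exists f'; split; [exists 2%N | exact: resolved_smooth hmu mu1].
pose m dir := if dir == d0 then n else 0%N.
have -> : n = (\sum_(dir <- [:: d0]) m dir)%N by rewrite big_seq1 /m eqxx.
apply: (@resolved_blow_up _ f 2 [:: d0] m f') => // [dir|dir|dir].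
- by rewrite inE /m => /negbTE ->.
- by have [] := hf' dir.
- by have [] := hf' dir.
Qed.

(** In a double direction the maximal contact of the strict transform is one less
    than that of [f]; in all other directions there is nothing left to resolve. *)
Lemma contact_resolved_by k f : has_mult f 2 ->
  contact k.+1 f -> ~ contact k.+2 f -> resolved_by k.+1 f.
Proof.
elim: k f => [|k IH] f hf hc hn; have /has_multE [h2 h3] := hf;
  have [a [b [c [r [ef hr]]]]] := quadratic_part h2;
  have nz : [|| a != 0, b != 0 | c != 0] by [apply: (quadric_neq0 hr); rewrite -ef];
  have simple dir : ~ double_direction a b c dir ->
    exists f', f \mPo blow_down dir = exceptional dir ^+ 2 * f' /\
         exists2 mu, has_mult f' mu & (mu <= 1)%N
    by [have [f' e] := order_ge_blow_down dir h2; exists f'; split=> //;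
        rewrite ef in e; exact: simple_direction e _].
  have [[d0 dd]|nd] := pselect (exists d0, double_direction a b c d0); last first.
    by apply: resolved_by_simple => // dir; apply: simple => dd; apply: nd; exists dir.
  have [f0 e0] := order_ge_blow_down d0 h2.
  have [o1 o3] : order_ge 1 f0 /\ ~ order_ge 3 f0.
    by rewrite ef in e0; exact: double_direction_order e0 dd.
  apply: (@resolved_by_double _ 0 d0 f0) => //; first by exists 2%N.
    apply: (@resolved_smooth _ _ 1) => //; apply/has_multE; split=> // /contact1 c1.
    by apply: hn; rewrite ef in e0 *; exact: contact_of_strict_transform e0 dd c1.
  by move=> dir /eqP ne; apply: simple => /(double_direction_inj nz dd) /esym.
have [d0 dd] : exists d0, double_direction a b c d0.
  by move: hc; rewrite ef; exact: contact_double_direction.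
have [f0 e0] := order_ge_blow_down d0 h2.
have [o1 o3] : order_ge 1 f0 /\ ~ order_ge 3 f0.
  by rewrite ef in e0; exact: double_direction_order e0 dd.
have hc0 : contact k.+1 f0.
  by rewrite ef in e0 hc; exact: contact_strict_transform e0 dd hc.
apply: (@resolved_by_double _ _ d0 f0) => //; first by exists 2%N.
  apply: IH => //.
    by apply/has_multE; split=> //; exact: contact_order_ge hc0.
  by move=> c1; apply: hn; rewrite ef in e0 *; exact: contact_of_strict_transform e0 dd c1.
by move=> dir /eqP ne; apply: simple => /(double_direction_inj nz dd) /esym.
Qed.

End ResolutionByContact.

(** * Elimination *)

Section ContactBound.
Variable K : fieldType.
Local Notation A := {mpoly K[2]}.
Local Notation X := ('X_ord0 : A).
Local Notation Y := ('X_ord_max : A).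
Implicit Types (f g u v r : A) (h p q : {poly K}) (a b c t : K).

Definition to_polyY f : {poly {poly K}} :=
  mmap (@polyC {poly K} \o @polyC K) (tnth [tuple 'X%:P; 'X]) f.

Lemma to_polyYD u v : to_polyY (u + v) = to_polyY u + to_polyY v.
Proof. by rewrite /to_polyY rmorphD. Qed.

Lemma to_polyYM u v : to_polyY (u * v) = to_polyY u * to_polyY v.
Proof. by rewrite /to_polyY rmorphM. Qed.

Lemma to_polyYC c : to_polyY c%:MP = c%:P%:P.
Proof. exact: mmapC. Qed.

Lemma to_polyYX : to_polyY X = 'X%:P.
Proof. by rewrite /to_polyY mmapX mmap1U. Qed.

Lemma to_polyYY : to_polyY Y = 'X.
Proof. by rewrite /to_polyY mmapX mmap1U. Qed.

Lemma xpolyB p q : xpoly (p - q) = xpoly p - xpoly q :> A.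
Proof. by rewrite xpolyD xpolyN. Qed.

Lemma xpoly_monoid_morphism : monoid_morphism (@xpoly K).
Proof. by split; [exact: (xpolyC 1) | exact: xpolyM]. Qed.

HB.instance Definition _ :=
  GRing.isZmodMorphism.Build {poly K} A (@xpoly K) xpolyB.
HB.instance Definition _ :=
  GRing.isMonoidMorphism.Build {poly K} A (@xpoly K) xpoly_monoid_morphism.

Definition of_polyY (P : {poly {poly K}}) : A := (map_poly (@xpoly K) P).[Y].

Lemma of_polyYD P Q : of_polyY (P + Q) = of_polyY P + of_polyY Q.
Proof. by rewrite /of_polyY rmorphD hornerD. Qed.

Lemma of_polyYM P Q : of_polyY (P * Q) = of_polyY P * of_polyY Q.
Proof. by rewrite /of_polyY rmorphM hornerM. Qed.

Lemma of_polyYC p : of_polyY p%:P = xpoly p.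
Proof. by rewrite /of_polyY map_polyC hornerC. Qed.

Lemma of_polyYX : of_polyY 'X = Y.
Proof. by rewrite /of_polyY map_polyX hornerX. Qed.

Lemma to_polyYK : cancel to_polyY of_polyY.
Proof.
elim/mpoly2_ind => [c|||u v hu hv|u v hu hv].
- by rewrite to_polyYC of_polyYC xpolyC.
- by rewrite to_polyYX of_polyYC xpolyX.
- by rewrite to_polyYY of_polyYX.
- by rewrite to_polyYD of_polyYD hu hv.
- by rewrite to_polyYM of_polyYM hu hv.
Qed.

Lemma to_polyY_xpoly p : to_polyY (xpoly p) = p%:P.
Proof.
elim/poly_ind: p => [|p c IH]; first by rewrite xpoly0 -mpolyC0 to_polyYC.
by rewrite !xpolyE to_polyYD to_polyYM IH to_polyYX to_polyYC polyCD polyCM.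
Qed.

Lemma of_polyYK : cancel of_polyY to_polyY.
Proof.
elim/poly_ind => [|P p IH].
  by rewrite -(polyC0 {poly K}) of_polyYC to_polyY_xpoly.
by rewrite of_polyYD of_polyYM of_polyYC of_polyYX to_polyYD to_polyYM to_polyYY IH
  to_polyY_xpoly.
Qed.

Definition divides f g := exists u, g = u * f.

Definition mpoly_prime f := forall u v, divides f (u * v) -> divides f u \/ divides f v.

Lemma to_polyY_eq0 f : (to_polyY f == 0) = (f == 0).
Proof.
apply/eqP/eqP => [e|->]; last by rewrite -mpolyC0 to_polyYC.
by rewrite -[f]to_polyYK e -(polyC0 {poly K}) of_polyYC xpoly0.
Qed.

(** Elimination of [y]: the resultant of [f] and [g] vanishes only if they have
    a common factor over [K(x)], which has to be [f] when [f] is prime. *)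
Lemma elimination f g : mpoly_prime f -> (1 < size (to_polyY f))%N ->
    ~ divides f g ->
  exists (p : {poly K}) u v, p != 0 /\ xpoly p = u * f + v * g.
Proof.
move=> pf sf ng.
have ng0 : to_polyY g != 0.
  by rewrite to_polyY_eq0; apply/eqP => g0; apply: ng; exists 0; rewrite g0 mul0r.
have nf0 : to_polyY f != 0 by rewrite -size_poly_gt0; exact: leq_trans sf.
have [sg|sg] := leqP (size (to_polyY g)) 1.
  exists (to_polyY g)`_0, 0, 1; rewrite -of_polyYC -(size1_polyC sg) to_polyYK.
  by split; [rewrite -polyC_eq0 -size1_polyC | ring].
have [R0|nR] := eqVneq (resultant (to_polyY f) (to_polyY g)) 0; last first.
  have [[u v] /= _ e] := resultant_in_ideal sf sg.
  exists (resultant (to_polyY f) (to_polyY g)), (of_polyY u), (of_polyY v).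
  by split=> //; rewrite -of_polyYC e of_polyYD !of_polyYM !to_polyYK.
exfalso; move/eqP: R0; rewrite resultant_eq0; set D := gcdp _ _ => sD.
have nconst p u : p != 0 -> xpoly p <> u * f.
  move=> np /(congr1 to_polyY); rewrite to_polyY_xpoly to_polyYM => e.
  have nu : to_polyY u != 0.
    apply/eqP => u0; move: e; rewrite u0 mul0r => /eqP.
    by rewrite polyC_eq0 (negbTE np).
  have := congr1 (fun P : {poly {poly K}} => size P) e.
  rewrite size_polyC np size_mul // => e1.
  have : (0 < size (to_polyY u))%N by rewrite size_poly_gt0.
  by move: sf e1; case: (size (to_polyY u)) => // n; case: (size (to_polyY f)) => [|[]] //= m; lia.
have /Pdiv.Idomain.dvdpP [[c q] /= nc ef] : D %| to_polyY f by exact: dvdp_gcdl.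
have /Pdiv.Idomain.dvdpP [[c' q'] /= nc' eg] : D %| to_polyY g by exact: dvdp_gcdr.
have [| [w ew] | [w ew]] := pf (of_polyY q) (of_polyY D).
- exists (xpoly c); rewrite -of_polyYM -ef -mul_polyC of_polyYM of_polyYC to_polyYK //.
- have e2 : c%:P = to_polyY w * D.
    apply: (mulIf nf0); rewrite mul_polyC ef -[q]of_polyYK ew to_polyYM; ring.
  have := congr1 (fun P : {poly {poly K}} => size P) e2.
  have nw : to_polyY w != 0.
    by apply/eqP => w0; move/eqP: e2; rewrite w0 mul0r polyC_eq0 (negbTE nc).
  have nD : D != 0 by rewrite -size_poly_gt0; exact: leq_trans sD.
  rewrite size_polyC nc size_mul //.
  have : (0 < size (to_polyY w))%N by rewrite size_poly_gt0.
  by move: sD; case: (size (to_polyY w)) => // n; case: (size D) => [|[]] //= m; lia.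
- have [| [z ez] | //] := pf (xpoly c') g.
    exists (of_polyY q' * w); rewrite -mulrA -ew -of_polyYM -eg -mul_polyC.
    by rewrite of_polyYM of_polyYC to_polyYK.
  exact: nconst nc' ez.
Qed.

Lemma mderivY_X : mderiv ord_max X = 0.
Proof. by rewrite mderivX mnmE /= scale0r. Qed.

Lemma mderivY_Y : mderiv ord_max Y = 1.
Proof.
rewrite mderivX mnmE eqxx scale1r.
have -> : (U_(ord_max) - U_(ord_max) = 0 :> 'X_{1..2})%MM.
  by apply/mnmP => i; rewrite mnmBE subnn mnm0E.
exact: mpolyX0.
Qed.

Lemma to_polyY_mderiv f : to_polyY (mderiv ord_max f) = (to_polyY f)^`().
Proof.
elim/mpoly2_ind: f => [c|||u v hu hv|u v hu hv].
- by rewrite mderivC to_polyYC derivC -mpolyC0 to_polyYC.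
- by rewrite to_polyYX derivC mderivY_X -mpolyC0 to_polyYC.
- by rewrite to_polyYY derivX mderivY_Y -mpolyC1 to_polyYC.
- by rewrite mderivD !to_polyYD hu hv derivD.
- by rewrite mderivM to_polyYD !to_polyYM hu hv derivM.
Qed.

Lemma order_ge_mderiv k f : order_ge k.+1 f -> order_ge k (mderiv ord_max f).
Proof.
elim: k f => // k IH f [u [v [-> hu hv]]].
rewrite mderivD !mderivM; apply: order_geD; apply: order_geD.
- by apply: order_geMl.
- by rewrite -add1n; apply: order_geM; [exact: order_geX | exact: IH].
- by apply: order_geMl.
- by rewrite -add1n; apply: order_geM; [exact: order_geY | exact: IH].
Qed.

End ContactBound.

(** * Boundedness of the contact *)

Section MaximalContact.
Variable K : fieldType.
Local Notation A := {mpoly K[2]}.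
Local Notation X := ('X_ord0 : A).
Local Notation Y := ('X_ord_max : A).
Implicit Types (f g u v r : A) (h p q : {poly K}) (t : K).

Local Notation quadric a b c :=
  (a%:MP * X ^+ 2 + b%:MP * X * Y + c%:MP * Y ^+ 2).

Lemma quadric_deriv_neq0 f (a b c : K) r :
    f = quadric a b c + r -> order_ge 3 r -> c != 0 -> 2%:R != 0 :> K ->
  (to_polyY f)^`() != 0.
Proof.
move=> ef hr nc n2; rewrite -to_polyY_mderiv to_polyY_eq0.
apply/eqP => e; have := @linear_part_eq0 K b (c *+ 2) (mderiv ord_max r); case.
- have -> : b%:MP * X + (c *+ 2)%:MP * Y + mderiv ord_max r = mderiv ord_max f.
    rewrite ef !expr2 !(mderivD, mderivM, mderivC, mderivY_X, mderivY_Y) mpolyCMn; ring.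
  by rewrite e; exact: order_ge_0.
- exact: order_ge_mderiv.
- by move=> _ /eqP; rewrite -mulr_natr mulf_eq0 (negbTE nc) (negbTE n2).
Qed.

Lemma deriv_neq0_size (R : nzRingType) (P : {poly R}) : P^`() != 0 -> (1 < size P)%N.
Proof.
by apply: contra_neqT; rewrite -leqNgt => /size1_polyC ->; rewrite derivC.
Qed.

(** If [f] lies in the square of (y - h, x^k), then [f] and its derivative in y
    vanish on the graph of h modulo x^k, and so does their eliminant, a nonzero
    element of K[x] that depends neither on h nor on k. *)
Lemma contact_bounded f (a b c : K) r : mpoly_prime f ->
    f = quadric a b c + r -> order_ge 3 r -> c != 0 -> 2%:R != 0 :> K ->
  exists n, ~ contact n.+1 f.
Proof.
move=> pf ef hr nc n2; have sf' := quadric_deriv_neq0 ef hr nc n2.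
have sf := deriv_neq0_size sf'.
have nd : ~ divides f (mderiv ord_max f).
  case=> w /(congr1 (@to_polyY K)); rewrite to_polyYM to_polyY_mderiv => e.
  have nw : to_polyY w != 0.
    by apply/eqP => w0; move: sf'; rewrite e w0 mul0r eqxx.
  have nf : to_polyY f != 0 by rewrite -size_poly_gt0; exact: leq_trans sf.
  have := lt_size_deriv nf; rewrite e size_mul //.
  move: nw; rewrite -size_poly_gt0; case: (size (to_polyY w)) => // m _.
  by rewrite addSn /= ltnNge leq_addl.
have [p [u [v [np ep]]]] := elimination pf sf nd.
exists (size p) => hc.
have [h [h0 [a' [b' [c' nf]]]]] := contact_normal_form nc ef hr hc.
set n := size p in hc nf.
set G := Y - xpoly h in nf; set Z := X ^+ n.+1 in nf.
have {}nf : f = c' * (G * G) + xpoly b' * (Z * G) + xpoly a' * (Z * Z).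
  by rewrite nf mul2n -addnn exprD -/Z; ring.
have [w ew] : exists w1 w2, xpoly p = G * w1 + Z * w2.
  set d := mderiv ord_max in ep *.
  have df : d f = G * (d c' * G + c' * d G *+ 2 + d (xpoly b') * Z + xpoly b' * d Z)
     + Z * (xpoly b' * d G + d (xpoly a') * Z + xpoly a' * d Z *+ 2).
    by rewrite nf /d !(mderivD, mderivM); ring.
  rewrite ep df nf.
  exists (u * (c' * G + xpoly b' * Z)
     + v * (d c' * G + c' * d G *+ 2 + d (xpoly b') * Z + xpoly b' * d Z)).
  exists (u * (xpoly a' * Z)
     + v * (xpoly b' * d G + d (xpoly a') * Z + xpoly a' * d Z *+ 2)).
  ring.
case: ew => w2 ew; have := congr1 (on_graph h) ew.
rewrite !on_graphE !on_graph_xpoly subrr mul0r add0r => {}ew.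
have nw : on_graph h w2 != 0.
  by apply/eqP => w0; move: np; rewrite ew w0 mulr0 eqxx.
have := congr1 (fun q : {poly K} => size q) ew.
rewrite size_monicM ?monicXn // size_polyXn -/n => e.
by move: nw e; rewrite -size_poly_gt0; lia.
Qed.

Lemma maximal_contact f : order_ge 2 f -> (exists n, ~ contact n.+1 f) ->
  exists k, contact k.+1 f /\ ~ contact k.+2 f.
Proof.
move=> h2 [n]; elim: n => [|n IH] hn; first by case: hn; exact: contact1.
by have [hc|hc] := pselect (contact n.+1 f); [exists n | exact: IH].
Qed.

Lemma normal_form_lead f (a b c : K) r h (a' b' : {poly K}) (c' : A) k :
    f = quadric a b c + r -> order_ge 3 r -> h.[0] = 0 -> (0 < k)%N ->
    f = c' * (Y - xpoly h) ^+ 2 + xpoly b' * X ^+ k * (Y - xpoly h)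
        + xpoly a' * X ^+ (2 * k) ->
  c'.@[fun=> 0] = c.
Proof.
move=> ef hr /poly_factorX [h1 eh] k0 ef'.
have := order_ge_comp (order_ge_0 1) order_geY hr.
have : f \mPo [tuple 0; Y] = (c' \mPo [tuple 0; Y]) * Y ^+ 2.
  rewrite ef' eh xpolyM xpolyX !comp_simp comp_XE comp_YE !expr0n muln_eq0 /= eqn0Ngt k0 /=.
  ring.
have -> : f \mPo [tuple 0; Y] = c%:MP * Y ^+ 2 + (r \mPo [tuple 0; Y]).
  rewrite ef !comp_simp comp_XE comp_YE; ring.
have [s [dc hs]] := const_term c'; move: (c'.@[_]) dc => c0 -> e hr'.
have e0 : c0 - c = 0; last by apply/eqP; rewrite -subr_eq0 e0.
apply: (@order_ge_monomial K _ ord_max 2).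
have -> : (c0 - c)%:MP * Y ^+ 2 = (r \mPo [tuple 0; Y]) + (- 1) * ((s \mPo [tuple 0; Y]) * Y ^+ 2).
  have -> : r \mPo [tuple 0; Y]
      = (c%:MP * Y ^+ 2 + (r \mPo [tuple 0; Y])) - c%:MP * Y ^+ 2 by ring.
  by rewrite e !comp_simp mpolyCB; ring.
apply: order_geD => //; apply: order_geMl; apply: (@order_geM _ 1 2).
  by apply: order_ge_comp => //; [exact: order_ge_0 | exact: order_geY].
exact: order_ge_exp order_geY.
Qed.

End MaximalContact.

(** * Normal form at maximal contact *)

Section MaximalNormalForm.
Variable K : closedFieldType.
Local Notation A := {mpoly K[2]}.
Local Notation X := ('X_ord0 : A).
Local Notation Y := ('X_ord_max : A).
Implicit Types (f g u v r : A) (h p q : {poly K}) (t : K).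

Local Notation quadric a b c :=
  (a%:MP * X ^+ 2 + b%:MP * X * Y + c%:MP * Y ^+ 2).

Lemma quadratic_roots (a b c : K) : c != 0 ->
  exists w1 w2, b = - (c * (w1 + w2)) /\ a = c * w1 * w2.
Proof.
move=> nc.
have [w1 e] := @solve_monicpoly K 2 (fun i => if i is 0 then - a / c else - b / c) isT.
exists w1, (- b / c - w1); split; first by field.
have {}e : w1 ^+ 2 + (a / c + b / c * w1) = 0.
  by rewrite e !big_ord_recl big_ord0 /= expr0 expr1; field.
have -> : c * w1 * (- b / c - w1) = - (c * (w1 ^+ 2 + (a / c + b / c * w1))) + a by field.
by rewrite e mulr0 oppr0 add0r.
Qed.

(** The quadratic polynomial in question is the restriction of the last strict
    transform to the exceptional line. If it had a double root at which the strict
    transform is singular, the graph displaced by this root would have contact one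
    order higher. *)
Lemma maximal_normal_form f (a b c : K) r k :
    f = quadric a b c + r -> order_ge 3 r -> c != 0 ->
    contact k.+1 f -> ~ contact k.+2 f ->
  exists h (a' b' : {poly K}) (c' : A),
    [/\ h.[0] = 0,
        f = c' * (Y - xpoly h) ^+ 2 + xpoly b' * X ^+ k.+1 * (Y - xpoly h)
          + xpoly a' * X ^+ (2 * k.+1),
        c'.@[fun=> 0] != 0
      & (exists w1 w2, [/\ w1 <> w2, b'.[0] = - (c'.@[fun=> 0] * (w1 + w2))
                        & a'.[0] = c'.@[fun=> 0] * w1 * w2]) \/
        (exists a1 b1, [/\ a' = 'X * a1, b' = 'X * b1 & a1.[0] <> 0])].
Proof.
move=> ef hr nc hc hn.
have [h [h0 [a1 [b1 [c1 e1]]]]] := contact_normal_form nc ef hr hc.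
have ec1 := normal_form_lead ef hr h0 (isT : 0 < k.+1)%N e1.
have [w1 [w2 [eb ea]]] := quadratic_roots a1.[0] b1.[0] nc.
have [ew|/eqP nw] := eqVneq w1 w2; last first.
  exists h, a1, b1, c1; split=> //; first by rewrite ec1.
  by left; exists w1, w2; rewrite ec1.
(* Displacing the graph by the double root moves this root to zero. *)
rewrite -ew in eb ea; pose h2 := h + w1%:P * 'X^(k.+1).
have h20 : h2.[0] = 0 by rewrite hornerD hornerCM hornerXn h0 expr0n mulr0 addr0.
have [|a2 [b2 [c2 [e2 ea2 eb2]]]] := @normalize_coefs _ k.+1 h2
    (c1 * w1%:MP ^+ 2 + xpoly b1 * w1%:MP + xpoly a1)
    (c1 * w1%:MP *+ 2 + xpoly b1) c1 f h20 isT.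
  rewrite e1 /h2 xpolyD xpolyM xpolyC xpolyXn mul2n -addnn exprD.
  by move: (X ^+ k.+1) => Z; ring.
have ec2 := normal_form_lead ef hr h20 (isT : 0 < k.+1)%N e2.
rewrite !mevalD !mevalM ec1 !mevalC !meval_xpoly in ea2.
rewrite !mevalD meval_xpoly mevalM ec1 !mevalC in eb2.
exists h2, a2, b2, c2; split=> //; first by rewrite ec2.
have [b3 eb3] : exists b3, b2 = 'X * b3 by apply: poly_factorX; rewrite eb2 eb; ring.
have [a3 ea3] : exists a3, a2 = 'X * a3 by apply: poly_factorX; rewrite ea2 eb ea; ring.
right; exists a3, b3; split=> // /poly_factorX [a4 ea4]; apply: hn.
apply: (@normal_form_contact _ _ h2) => //; exists a4, b3, c2.
rewrite e2 ea3 ea4 eb3 !xpolyM !xpolyX !mulnS !exprD !exprS; ring.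
Qed.

End MaximalNormalForm.

(** * The ring of the last strict transform *)

(** The properties of x and g = y - h(x) at maximal contact that do not mention the
    coordinates of the plane: x and g generate the maximal ideal, have no relation
    but the obvious ones, and every nonzero function on the curve divides a nonzero
    function of x, written as a power of x times a unit at the origin. *)
Record normal_presentation (K L : fieldType) (phi : {rmorphism {mpoly K[2]} -> L})
    (f x g a b c : {mpoly K[2]}) (r : nat) : Prop := NormalPresentation {
  np_field : is_function_field phi f;
  np_gt0 : (0 < r)%N;
  np_x0 : x.@[fun=> 0] = 0;
  np_g0 : g.@[fun=> 0] = 0;
  np_gen : forall p, p.@[fun=> 0] = 0 -> exists p1 p2, p = x * p1 + g * p2;
  np_indep : forall p q, x ^+ r * p + g * q = 0 ->
    p.@[fun=> 0] = 0 /\ q.@[fun=> 0] = 0;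
  np_eq : f = c * g ^+ 2 + b * x ^+ r * g + a * x ^+ (2 * r);
  np_lead : c.@[fun=> 0] != 0;
  np_neq0 : phi x != 0;
  np_clear : forall p, phi p != 0 ->
    exists e s q, s.@[fun=> 0] != 0 /\ phi (x ^+ e * s) = phi (q * p)
}.

Section BranchRing.
Variables (K L : fieldType) (phi : {rmorphism {mpoly K[2]} -> L}).
Variables (f x g a b c : {mpoly K[2]}) (r : nat).
Local Notation A := {mpoly K[2]}.
Local Notation ev u := (u.@[fun=> 0]).
Local Notation k t := (phi t%:MP).
Implicit Types (u v z n : L) (p q s : A) (al be om t : K).

Hypothesis pres : normal_presentation phi f x g a b c r.

Let Lf := np_field pres.
Let r_gt0 := np_gt0 pres.
Let x_0 := np_x0 pres.
Let g_0 := np_g0 pres.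
Let xg_gen := np_gen pres.
Let xg_indep := np_indep pres.
Let f_eq := np_eq pres.
Let c_0 := np_lead pres.
Let phix := np_neq0 pres.
Let clear_denom := np_clear pres.

(** The coordinate of the last strict transform on the exceptional line. The lock
    prevents unification from reading it as a quotient. *)
Definition slope : L := locked (phi g / phi x ^+ r).
Local Notation w := slope.

(** The local ring of the curve at the origin with the slope adjoined. The slope
    satisfies a quadratic equation with invertible leading coefficient, so that
    linear expressions in it suffice. *)
Definition branch_ring : set L :=
  [set u | exists s p q, ev s != 0 /\ phi s * u = phi p + phi q * w].
Local Notation B := branch_ring.
Local Notation N := (normalization phi).

Lemma phi_f0 : phi f = 0.
Proof. by apply/(proj1 Lf f); exists 1; rewrite mul1r. Qed.

Lemma phi_gE : phi g = phi x ^+ r * w.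
Proof. by rewrite /slope -lock mulrC divfK // expf_neq0. Qed.

Lemma slope_eq : phi c * w ^+ 2 + phi b * w + phi a = 0.
Proof.
have nx : phi x ^+ r != 0 by rewrite expf_neq0.
have := phi_f0; rewrite f_eq mul2n -addnn exprD !(rmorphD, rmorphM, rmorphXn) /= phi_gE.
move: (phi x ^+ r) nx => X nX e; apply: (mulfI nX); apply: (mulfI nX).
by rewrite !mulr0 -e; ring.
Qed.

Lemma ev_xX m : (0 < m)%N -> ev (x ^+ m) = 0.
Proof. by case: m => // m _; rewrite exprS mevalM x_0 mul0r. Qed.

Lemma phi_unit s : ev s != 0 -> phi s != 0.
Proof.
move=> hs; apply/eqP => /(proj1 Lf s) [h e]; move: hs; rewrite e mevalM.
have -> : ev f = 0.
  rewrite f_eq expr2 !mevalD !mevalM g_0 !ev_xX ?muln_gt0 //; ring.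
by rewrite mulr0 eqxx.
Qed.

Lemma kM al be : k (al * be) = k al * k be.
Proof. by rewrite mpolyCM rmorphM. Qed.

Lemma k_neq0 al : al != 0 -> k al != 0.
Proof. by move=> h; apply: phi_unit; rewrite mevalC. Qed.

Lemma branch_phi p : B (phi p).
Proof. by exists 1, p, 0; rewrite meval1 oner_neq0 rmorph1 rmorph0; split=> //; ring. Qed.

Lemma branch_slope : B w.
Proof. by exists 1, 0, 1; rewrite meval1 oner_neq0 rmorph1 rmorph0; split=> //; ring. Qed.

Lemma branchD u v : B u -> B v -> B (u + v).
Proof.
move=> [s [p [q [hs e]]]] [s' [p' [q' [hs' e']]]].
exists (s * s'), (s' * p + s * p'), (s' * q + s * q'); rewrite mevalM mulf_neq0 //.
split=> //; rewrite !(rmorphD, rmorphM).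
have -> : phi s * phi s' * (u + v) = phi s' * (phi s * u) + phi s * (phi s' * v) by ring.
by rewrite e e'; ring.
Qed.

Lemma branchM u v : B u -> B v -> B (u * v).
Proof.
move=> [s [p [q [hs e]]]] [s' [p' [q' [hs' e']]]].
exists (c * (s * s')), (c * (p * p') - q * q' * a),
  (c * (p * q' + q * p') - q * q' * b).
rewrite !mevalM !mulf_neq0 //.
split=> //; rewrite !(rmorphD, rmorphM, rmorphN).
have -> : phi c * (phi s * phi s') * (u * v) = phi c * ((phi s * u) * (phi s' * v)) by ring.
rewrite e e'; apply/eqP; rewrite -subr_eq0; apply/eqP.
rewrite -[RHS](mulr0 (phi q * phi q')) -slope_eq; ring.
Qed.

Lemma branchN u : B u -> B (- u).
Proof. by rewrite -mulN1r -(rmorph1 phi) -rmorphN; apply: branchM; exact: branch_phi. Qed.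

Lemma branch0 : B 0. Proof. by rewrite -(rmorph0 phi); exact: branch_phi. Qed.
Lemma branch1 : B 1. Proof. by rewrite -(rmorph1 phi); exact: branch_phi. Qed.

Lemma branchX u m : B u -> B (u ^+ m).
Proof.
by move=> hu; elim: m => [|m IH]; [exact: branch1 | rewrite exprS; exact: branchM].
Qed.

Lemma branch_inv s : ev s != 0 -> B (phi s)^-1.
Proof.
move=> hs; exists s, 1, 0; split=> //.
by rewrite mulfV ?phi_unit // rmorph1 rmorph0; ring.
Qed.

Lemma phi_expand p : exists2 z, B z & phi p = k (ev p) + phi x * z.
Proof.
have [|p1 [p2 e]] := xg_gen (p := p - (ev p)%:MP); first by rewrite mevalB mevalC subrr.
exists (phi p1 + phi x ^+ r.-1 * w * phi p2).
  apply: branchD; first exact: branch_phi.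
  apply: branchM; last exact: branch_phi.
  by apply: branchM; [apply: branchX; exact: branch_phi | exact: branch_slope].
rewrite -[p in LHS](subrK (ev p)%:MP) e rmorphD [X in X + _]rmorphD !rmorphM phi_gE.
by rewrite -{1}(prednK r_gt0) exprS; ring.
Qed.

Lemma branch_expand u : B u ->
  exists al be z, B z /\ u = k al + k be * w + phi x * z.
Proof.
move=> hu; have [s [p [q [hs e]]]] := hu.
have [zs Bs es] := phi_expand s; have [zp Bp ep] := phi_expand p.
have [zq Bq eq] := phi_expand q; have ks := k_neq0 hs.
exists (ev p / ev s), (ev q / ev s), ((phi (ev s)%:MP)^-1 * (zp + zq * w - zs * u)).
split.
  apply: branchM; first by apply: branch_inv; rewrite mevalC.
  apply: branchD; last by apply: branchN; exact: branchM.
  by apply: branchD => //; apply: branchM => //; exact: branch_slope.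
have kd t : k (ev s) * k (t / ev s) = k t by rewrite -kM mulrC divfK.
apply: (mulfI ks); rewrite 2!mulrDr kd [k _ * (k _ * w)]mulrA kd.
rewrite [k _ * (phi x * _)]mulrCA mulVKf //.
move: e; rewrite es ep eq => e.
have -> : k (ev s) * u = (k (ev s) + phi x * zs) * u - phi x * zs * u by ring.
by rewrite e; ring.
Qed.

(** The quotient of the branch ring by x has the basis 1, w. Clearing denominators,
    a relation between 1 and w modulo x becomes one between x^r and g modulo f; as
    f lies in the square of (x^r, g), it makes the coefficients vanish at the
    origin. *)
Lemma branch_free al be z : B z -> k al + k be * w = phi x * z -> al = 0 /\ be = 0.
Proof.
move=> [s [p [q [hs e]]]] e1.
have e2 : phi (s * (al%:MP * x ^+ r + be%:MP * g) - x * (p * x ^+ r + q * g)) = 0.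
  rewrite !(rmorphD, rmorphN, rmorphM, rmorphXn) /= phi_gE.
  have -> : forall X, phi s * (k al * X + k be * (X * w)) - phi x * (phi p * X + phi q * (X * w))
    = X * (phi s * (k al + k be * w) - phi x * (phi p + phi q * w)) by move=> X; ring.
  by rewrite e1 -e; ring.
have [h e3] := proj1 (proj1 Lf _) e2.
have [] := @xg_indep (s * al%:MP - x * p - h * b * g - h * a * x ^+ r)
  (s * be%:MP - x * q - h * c * g).
  move/eqP: e3; rewrite -subr_eq0 f_eq mul2n -addnn exprD => /eqP <-; ring.
rewrite !(mevalB, mevalM) !mevalC x_0 g_0 ev_xX //.
rewrite !mul0r !mulr0 !subr0 => /eqP + /eqP.
by rewrite !mulf_eq0 (negbTE hs) => /eqP -> /eqP ->.
Qed.

(** When [om] is a root of the equation of the slope on the exceptional line, the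
    maximal ideal of the corresponding point. *)
Definition branch_point om : set L :=
  [set u | exists be z, B z /\ u = k be * (w - k om) + phi x * z].

Lemma point_branch om u : branch_point om u -> B u.
Proof.
move=> [be [z [Bz ->]]]; apply: branchD; apply: branchM => //; try exact: branch_phi.
by apply: branchD; [exact: branch_slope | apply: branchN; exact: branch_phi].
Qed.

Lemma pointD om u v : branch_point om u -> branch_point om v -> branch_point om (u + v).
Proof.
move=> [be [z [Bz ->]]] [be' [z' [Bz' ->]]]; exists (be + be'), (z + z').
by rewrite mpolyCD rmorphD; split; [exact: branchD | ring].
Qed.

Lemma point_x om z : B z -> branch_point om (phi x * z).
Proof. by move=> Bz; exists 0, z; rewrite mpolyC0 rmorph0; split=> //; ring. Qed.

Lemma point_slope om : branch_point om (w - k om).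
Proof.
by exists 1, 0; rewrite mpolyC1 rmorph1; split; [exact: branch0 | ring].
Qed.

Lemma point_value om u : B u -> exists al, branch_point om (u - k al).
Proof.
move=> /branch_expand [al [be [z [Bz ->]]]]; exists (al + be * om), be, z.
by split=> //; rewrite mpolyCD rmorphD kM; ring.
Qed.

Lemma point_const om al : branch_point om (k al) -> al = 0.
Proof.
move=> [be [z [Bz e]]]; have [] := @branch_free (al + be * om) (- be) z Bz.
  by rewrite mpolyCD mpolyCN rmorphD rmorphN kM e; ring.
move=> e1 /eqP; rewrite oppr_eq0 => /eqP be0.
by move: e1; rewrite be0 mul0r addr0.
Qed.

Lemma point_phi om p : branch_point om (phi p) <-> ev p = 0.
Proof.
have [z Bz ->] := phi_expand p; split=> [h|->].
  apply: (@point_const om).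
  have -> : k (ev p) = (k (ev p) + phi x * z) + phi x * (- z) by ring.
  by apply: pointD => //; apply: point_x; exact: branchN.
by rewrite mpolyC0 rmorph0 add0r; exact: point_x.
Qed.

(** * Orders of vanishing along the exceptional fibre *)

(** The functions on the plane that are divisible by x^m in the branch ring. *)
Definition branch_filtration m : set A :=
  [set p | exists z, B z /\ phi p = phi x ^+ m * z].

(** Freeness of the fibre shows that the constant term is zero; divide by x. *)
Lemma sum_power_eq0 m (d : nat -> K) z : B z ->
    \sum_(i < m) k (d i) * phi x ^+ i = phi x ^+ m * z ->
  forall i, (i < m)%N -> d i = 0.
Proof.
elim: m d z => // m IH d z Bz; rewrite big_ord_recl /= expr0 mulr1.
under eq_bigr => i _ do rewrite /bump /= add1n exprS mulrCA.
rewrite -mulr_sumr => e; have d0 : d 0%N = 0.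
  set S := \sum_(_ < _) _ in e.
  have BS : B S.
    rewrite /S; elim: (index_enum _) => [|i s IHs]; first by rewrite big_nil; exact: branch0.
    rewrite big_cons; apply: branchD => //; apply: branchM; first exact: branch_phi.
    by apply: branchX; exact: branch_phi.
  have [] // := @branch_free (d 0%N) 0 (phi x ^+ m * z - S).
    apply: branchD; last exact: branchN.
    by apply: branchM => //; apply: branchX; exact: branch_phi.
  rewrite mulrBr mulrA -exprS -e mpolyC0 rmorph0; ring.
have {}e : \sum_(i < m) k (d i.+1) * phi x ^+ i = phi x ^+ m * z.
  by apply: (mulfI phix); rewrite mulrA -exprS -e d0 mpolyC0 rmorph0 add0r.
by move=> [|i] // im; exact: (IH (d \o S) z).
Qed.

Lemma power_expand m p : exists (d : nat -> K) p1 p2,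
  p = \sum_(i < m) (d i)%:MP * x ^+ i + x ^+ m * p1 + g * p2.
Proof.
elim: m p => [|m IH] p.
  by exists (fun=> 0), p, 0; rewrite big_ord0; ring.
have [|p1 [p2 e]] := xg_gen (p := p - (ev p)%:MP); first by rewrite mevalB mevalC subrr.
have [d [q1 [q2 e1]]] := IH p1.
exists (fun i => if i is i'.+1 then d i' else ev p), q1, (x * q2 + p2).
rewrite -[LHS](subrK (ev p)%:MP) e e1 big_ord_recl /= expr0 mulr1.
under [in RHS]eq_bigr => i _ do rewrite exprS mulrCA.
rewrite -mulr_sumr exprS; ring.
Qed.

Lemma filtration_le m l p : (l <= m)%N -> branch_filtration m p -> branch_filtration l p.
Proof.
move=> lm [z [Bz e]]; exists (phi x ^+ (m - l) * z).
rewrite mulrA -exprD subnKC //; split=> //.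
by apply: branchM => //; apply: branchX; exact: branch_phi.
Qed.

(** Write p = q(x) + e g. As g = x^r w, divisibility by x^(r+1) and freeness make q
    vanish up to order r and e vanish at the origin. *)
Lemma filtration_singular p : branch_filtration r.+1 p -> order_ge 2 p.
Proof.
move=> [z [Bz e]]; have [d [p1 [p2 ep]]] := power_expand r.+1 p.
have [y By ey] := phi_expand p2.
rewrite ep big_ord_recr /= !(rmorphD, rmorphM, rmorphXn) rmorph_sum /= phi_gE ey in e.
move: e; under eq_bigr => i _ do rewrite rmorphM rmorphXn /=.
set S := \sum_(_ < _) _ => e.
have Bx : B (phi x) by exact: branch_phi.
have e1 : S = phi x ^+ r * (phi x * (z - phi p1 - w * y) - (k (d r) + k (ev p2) * w)).
  have -> : S = (S + k (d r) * phi x ^+ r + phi x ^+ r.+1 * phi p1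
    + phi x ^+ r * w * (k (ev p2) + phi x * y)) - (k (d r) * phi x ^+ r + phi x ^+ r.+1 * phi p1
    + phi x ^+ r * w * (k (ev p2) + phi x * y)) by ring.
  by rewrite e exprS; ring.
have Bzpy : B (z - phi p1 - w * y).
  apply: branchD; last by apply: branchN; apply: branchM => //; exact: branch_slope.
  by apply: branchD => //; apply: branchN; exact: branch_phi.
have dz : forall i, (i < r)%N -> d i = 0.
  apply: sum_power_eq0 e1; apply: branchD; first exact: branchM.
  apply: branchN; apply: branchD; first exact: branch_phi.
  by apply: branchM; [exact: branch_phi | exact: branch_slope].
have S0 : S = 0.
  by rewrite /S big1 // => i _; rewrite dz // mpolyC0 rmorph0 mul0r.
have [dr p20] : d r = 0 /\ ev p2 = 0.
  apply: (branch_free Bzpy); apply: (mulfI (expf_neq0 r phix)).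
  by apply/eqP; rewrite -subr_eq0 -oppr_eq0 opprB -mulrBr -e1 S0.
have ox := proj2 (order_ge1E x) x_0; have og := proj2 (order_ge1E g) g_0.
rewrite ep big_ord_recr /= dr mpolyC0 mul0r addr0 big1 ?add0r; last first.
  by move=> i _; rewrite dz // mpolyC0 mul0r.
apply: order_geD.
  by apply: order_geMr; apply: (@order_geW _ r.+1) => //; exact: order_ge_exp.
by apply: (@order_geM _ 1 1) => //; apply/order_ge1E.
Qed.

(** For m <= r the function g = x^r w is divisible by x^m, so that the powers of x
    of exponent less than m span the quotient; they are independent by freeness. *)
Lemma filtration_length m : (m <= r)%N -> has_length (branch_filtration m) m.
Proof.
move=> mr; exists (fun i => x ^+ i) => p.
have [d [p1 [p2 ep]]] := power_expand m p.
have phiS (v : 'rV[K]_m) : phi (\sum_i v 0 i *: x ^+ i)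
    = \sum_(i < m) k (v 0 i) * phi x ^+ i.
  rewrite rmorph_sum /=; apply: eq_bigr => i _.
  by rewrite -mul_mpolyC rmorphM rmorphXn.
pose v0 : 'rV[K]_m := \row_i d i.
have sum0 : \sum_i v0 0 i *: x ^+ i = \sum_(i < m) (d i)%:MP * x ^+ i.
  by apply: eq_bigr => i _; rewrite mxE mul_mpolyC.
exists v0; split.
  exists (phi p1 + phi x ^+ (r - m) * w * phi p2); split.
    apply: branchD; first exact: branch_phi.
    apply: branchM; last exact: branch_phi.
    by apply: branchM; [apply: branchX; exact: branch_phi | exact: branch_slope].
  rewrite /= sum0.
  have -> : p - \sum_(i < m) (d i)%:MP * x ^+ i = x ^+ m * p1 + g * p2.
    by rewrite ep; move: (\sum_(_ < _) _) => S; ring.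
  rewrite !(rmorphD, rmorphM, rmorphXn) /= phi_gE -{1}(subnKC mr) exprD; ring.
move=> v [z [Bz e]]; apply/rowP => i; rewrite mxE.
pose d' j := if insub j is Some i0 then v 0 i0 else 0.
have d'E (i0 : 'I_m) : d' i0 = v 0 i0 by rewrite /d' valK.
suff h j : (j < m)%N -> d j - d' j = 0.
  by apply/eqP; rewrite -subr_eq0 -d'E h.
move: j; apply: (@sum_power_eq0 m (fun j => d j - d' j) (z - phi p1 - phi x ^+ (r - m) * w * phi p2)).
  apply: branchD.
    by apply: branchD => //; apply: branchN; exact: branch_phi.
  apply: branchN; apply: branchM; last exact: branch_phi.
  by apply: branchM; [apply: branchX; exact: branch_phi | exact: branch_slope].
have -> : \sum_(i0 < m) k (d i0 - d' i0) * phi x ^+ i0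
    = phi (\sum_(i0 < m) (d i0)%:MP * x ^+ i0) - phi (\sum_i0 v 0 i0 *: x ^+ i0).
  rewrite phiS rmorph_sum -sumrB; apply: eq_bigr => i0 _ /=.
  by rewrite mpolyCB rmorphB mulrBl d'E rmorphM rmorphXn.
rewrite /= in e; move: (\sum_(_ < _) _) (\sum_i0 v 0 i0 *: x ^+ i0) ep e => S1 S2 ep e.
have -> : phi S1 - phi S2 = phi (p - S2) - phi (x ^+ m * p1 + g * p2).
  by rewrite -!rmorphB ep; congr (phi _); ring.
rewrite e !(rmorphD, rmorphM, rmorphXn) /= phi_gE -{1}(subnKC mr) exprD; ring.
Qed.

Lemma curvilinear_filtration m : has_mult g 1 ->
  curvilinear_in f (branch_filtration m) m <-> (m <= r)%N.
Proof.
move=> hg; split=> [[_ _ [p hp /has_multE [_ np]]]|mr].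
  rewrite leqNgt; apply/negP => rm; apply: np.
  by apply: filtration_singular; exact: filtration_le hp.
split.
- by exists 0; rewrite phi_f0 mulr0; split=> //; exact: branch0.
- exact: filtration_length.
- exists g => //; apply: (filtration_le mr); exists w.
  by rewrite phi_gE; split=> //; exact: branch_slope.
Qed.

(** * The normalization *)

Lemma normalizationD u v : N u -> N v -> N (u + v).
Proof. exact: integral_add. Qed.

Lemma normalizationM u v : N u -> N v -> N (u * v).
Proof. exact: integral_mul. Qed.

Lemma normalization_phi p : N (phi p).
Proof. exact: integral_id. Qed.

Lemma normalizationN u : N u -> N (- u).
Proof. exact: integral_opp. Qed.

Lemma normalization1 : N 1. Proof. exact: integral1. Qed.

Lemma normalizationX u m : N u -> N (u ^+ m).
Proof.
by move=> hu; elim: m => [|m IH]; [exact: normalization1 | rewrite exprS; exact: normalizationM].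
Qed.

(** It is a root of T^2 + b T + a c. *)
Lemma normalization_slope : N (phi c * w).
Proof.
pose P : {poly A} := 'X^2 + (b%:P * 'X + (a * c)%:P).
have sP : (size (b%:P * 'X + (a * c)%:P)%R < size ('X^2 : {poly A}))%N.
  rewrite size_polyXn size_MXaddC; case: ifP => // _.
  by rewrite ltnS; exact: size_polyC_leq1.
exists P; first by rewrite monicE lead_coefDl // lead_coefXn.
rewrite /P rmorphD /= map_polyXn rmorphD rmorphM /= map_polyX !map_polyC /= rootE.
rewrite !hornerD hornerXn hornerM hornerX !hornerC rmorphM; apply/eqP; rewrite -[RHS](mulr0 (phi c)) -slope_eq; ring.
Qed.

Lemma normalization_local z : B z -> exists s, ev s != 0 /\ N (phi s * z).
Proof.
move=> [s [p [q [hs e]]]]; exists (c * s); rewrite mevalM mulf_neq0 //; split=> //.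
rewrite rmorphM -mulrA e mulrDr mulrCA; apply: normalizationD; apply: normalizationM;
  by [exact: normalization_phi | exact: normalization_slope].
Qed.

(** Integrality over the branch ring. It is kept apart from integrality over the
    curve because the slope itself is integral only locally. *)
Definition integral_branch n := exists m (d : nat -> L),
  (forall i, B (d i)) /\ n ^+ m = \sum_(i < m) d i * n ^+ i.

Lemma branch_sum m (F : nat -> L) : (forall i, (i < m)%N -> B (F i)) -> B (\sum_(i < m) F i).
Proof.
elim: m => [|m IH] h; first by rewrite big_ord0; exact: branch0.
by rewrite big_ord_recr /=; apply: branchD; [apply: IH => i im; apply: h; exact: ltnW | exact: h].
Qed.

Lemma normalization_integral n : N n -> integral_branch n.
Proof.
move=> [P /monicP mP /rootP e]; pose Q := map_poly phi P.
have nP : P != 0.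
  by apply/eqP => P0; move/eqP: mP; rewrite P0 lead_coef0 eq_sym oner_eq0.
have sQ : size Q = (size P).-1.+1.
  by rewrite size_map_poly_id0 ?mP ?rmorph1 ?oner_neq0 // prednK // size_poly_gt0.
exists (size P).-1, (fun i => - phi P`_i); split; first by move=> i; apply: branchN; exact: branch_phi.
move: e; rewrite -/Q horner_coef sQ big_ord_recr /= coef_map /= -/(lead_coef P) mP rmorph1 mul1r.
move/eqP; rewrite addrC addr_eq0 => /eqP ->; rewrite -sumrN.
by apply: eq_bigr => i _; rewrite coef_map /= mulNr.
Qed.

Lemma integral_branchM (t0 : L) n : B t0 -> integral_branch n -> integral_branch (t0 * n).
Proof.
move=> Bt [m [d [Bd e]]]; exists m, (fun i => d i * t0 ^+ (m - i)); split.
  by move=> i; apply: branchM => //; exact: branchX.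
rewrite exprMn e mulr_sumr; apply: eq_bigr => i _.
by rewrite exprMn -{1}(subnK (ltnW (ltn_ord i))) exprD; ring.
Qed.

(** An integral equation for [n], multiplied by a power of [t0], puts a power of
    [t0 n] in the ideal of [t0], which is radical; so [t0] can be divided out. *)
Lemma radical_normal (t0 : L) : t0 != 0 -> B t0 ->
    (forall u m z, B u -> B z -> u ^+ m = t0 * z -> exists2 z', B z' & u = t0 * z') ->
  forall e n, integral_branch n -> B (t0 ^+ e * n) -> B n.
Proof.
move=> nt Bt rad; elim=> [|e IH] n hn; first by rewrite mul1r.
rewrite exprS -mulrA => Bn; apply: (IH _ hn).
have : integral_branch (t0 ^+ e * n).
  by apply: integral_branchM => //; exact: branchX.
move: (t0 ^+ e * n) Bn => n' Bn [m [d [Bd e1]]].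
have [||z' Bz' /(mulfI nt) -> //] :=
  @rad (t0 * n') m (\sum_(i < m) d i * t0 ^+ (m - i).-1 * (t0 * n') ^+ i) Bn.
- apply: (@branch_sum m (fun i => d i * t0 ^+ (m - i).-1 * (t0 * n') ^+ i)) => i _.
  apply: branchM; last exact: branchX.
  by apply: branchM => //; exact: branchX.
- rewrite exprMn e1 !mulr_sumr; apply: eq_bigr => i _.
  rewrite exprMn -{1}(subnK (ltnW (ltn_ord i))) exprD.
  by rewrite -{1}[(m - i)%N]prednK ?subn_gt0 // exprS; ring.
Qed.

Lemma branch_clear n : exists e, B (phi x ^+ e * n).
Proof.
have [p [q [nq ->]]] := proj2 Lf n.
have [e [s [v [hs es]]]] := clear_denom nq.
have ns := phi_unit hs; exists e.
have -> : phi x ^+ e * (phi p / phi q) = (phi s)^-1 * phi (v * p).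
  apply: (mulfI ns); rewrite mulVKf // rmorphM; move: es.
  rewrite !rmorphM rmorphXn /= => es.
  have -> : phi s * (phi x ^+ e * (phi p / phi q)) = phi x ^+ e * phi s * (phi p / phi q) by ring.
  by rewrite es; field.
by apply: branchM; [exact: branch_inv | exact: branch_phi].
Qed.

(** * Powers of an ideal of the normalization *)

Lemma ideal_exp_ideal Q m : is_ideal phi Q -> is_ideal phi (ideal_exp phi Q m).
Proof.
move=> [QN Q0 QD QM]; elim: m => [|m [IN I0 ID IM]] /=.
  split=> //; [exact: integral0 | exact: normalizationD | exact: normalizationM].
split.
- move=> u [s [hs ->]]; elim: s hs => [|v s IHs] hs; first by rewrite big_nil; exact: integral0.
  rewrite big_cons; apply: normalizationD; last by apply: IHs => y ys; apply: hs; rewrite inE ys orbT.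
  by have [h1 h2] := hs v (mem_head _ _); apply: normalizationM; [exact: QN | exact: IN].
- by exists [::]; rewrite big_nil.
- move=> u v [s [hs ->]] [s' [hs' ->]]; exists (s ++ s'); rewrite big_cat; split=> // y.
  by rewrite mem_cat => /orP [/hs|/hs'].
- move=> n u Nn [s [hs ->]]; exists [seq (n * y.1, y.2) | y <- s]; split.
    by move=> y /mapP [y' /hs [h1 h2] ->]; split=> //; exact: QM.
  by rewrite big_map mulr_sumr; apply: eq_bigr => y _; rewrite mulrA.
Qed.

Lemma ideal_exp_mem Q m u v : Q u -> ideal_exp phi Q m v -> ideal_exp phi Q m.+1 (u * v).
Proof.
move=> hu hv; exists [:: (u, v)]; rewrite big_seq1; split=> // y.
by rewrite inE => /eqP ->.
Qed.

Lemma ideal_exp_pow Q m u : Q u -> ideal_exp phi Q m (u ^+ m).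
Proof.
move=> hu; elim: m => [|m IH]; first exact: normalization1.
by rewrite exprS; exact: ideal_exp_mem.
Qed.

Lemma ideal_exp_sum Q m (T : L -> Prop) : T 0 -> (forall u v, T u -> T v -> T (u + v)) ->
    (forall u v, Q u -> ideal_exp phi Q m v -> T (u * v)) ->
  forall u, ideal_exp phi Q m.+1 u -> T u.
Proof.
move=> T0 TD TM u [s [hs ->]]; elim: s hs => [|v s IHs] hs; first by rewrite big_nil.
rewrite big_cons; apply: (TD); last by apply: IHs => y ys; apply: hs; rewrite inE ys orbT.
by have [h1 h2] := hs v (mem_head _ _); exact: TM.
Qed.

Lemma ideal_exp_decr Q m u : is_ideal phi Q -> ideal_exp phi Q m.+1 u -> ideal_exp phi Q m u.
Proof.
move=> hQ; have [IN I0 ID IM] := ideal_exp_ideal m hQ; move: u.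
apply: ideal_exp_sum => // u v hu hv; apply: IM => //.
by case: hQ => QN _ _ _; exact: QN.
Qed.

(** Modulo [Q] the function [s] is a nonzero constant; one order is gained each time
    it is replaced by this constant. *)
Lemma ideal_exp_local Q m s n : is_ideal phi Q -> (forall p, ev p = 0 -> Q (phi p)) ->
    ev s != 0 -> N n -> ideal_exp phi Q m (phi s * n) -> ideal_exp phi Q m n.
Proof.
move=> hQ hm hs Nn; elim: m => [|m IH] // h.
have hn := IH (ideal_exp_decr hQ h).
have [IN I0 ID IM] := ideal_exp_ideal m.+1 hQ.
have -> : n = k (ev s)^-1 * (phi s * n + phi ((ev s)%:MP - s) * n).
  rewrite -mulrDl -rmorphD addrC subrK mulrA -kM mulVf //.
  by rewrite mpolyC1 rmorph1 mul1r.
apply: IM; first exact: normalization_phi.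
apply: ID => //; apply: ideal_exp_mem => //; apply: hm.
by rewrite mevalB mevalC subrr.
Qed.

Lemma ideal_exp_branch Q (t0 y : L) m : is_ideal phi Q -> (forall n, N n -> B n) -> B t0 ->
    (forall u, Q u -> exists2 z, B z & t0 * u = y * z) ->
  forall n, ideal_exp phi Q m n -> exists2 z, B z & t0 ^+ m * n = y ^+ m * z.
Proof.
move=> hQ NB Bt hy; elim: m => [|m IH].
  by move=> n /NB Bn; exists n; rewrite ?mul1r.
apply: ideal_exp_sum.
- by exists 0; [exact: branch0 | ring].
- move=> u v [z Bz e] [z' Bz' e']; exists (z + z'); first exact: branchD.
  by rewrite !mulrDr e e'.
- move=> u v /hy [z Bz e] /IH [z' Bz' e']; exists (z * z'); first exact: branchM.
  have -> : t0 ^+ m.+1 * (u * v) = (t0 * u) * (t0 ^+ m * v) by rewrite exprS; ring.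
  by rewrite e e' exprS; ring.
Qed.

Lemma maximal_ideal_prime Q u v : is_maximal_ideal phi Q -> N u -> N v ->
  Q (u * v) -> Q u \/ Q v.
Proof.
move=> [[QN Q0 QD QM] nQ Qmax] Nu Nv huv.
pose J : set L := [set y | exists l n, [/\ Q l, N n & y = l + n * u]].
have [] := Qmax J.
- split.
  + by move=> y [q [n [hq Nn ->]]]; apply: normalizationD; [exact: QN | exact: normalizationM].
  + by exists 0, 0; split=> //; [exact: integral0 | ring].
  + move=> y y' [q [n [hq Nn ->]]] [q' [n' [hq' Nn' ->]]]; exists (q + q'), (n + n').
    by split; [exact: QD | exact: normalizationD | ring].
  + move=> l y Nl [q [n [hq Nn ->]]]; exists (l * q), (l * n).
    by split; [exact: QM | exact: normalizationM | ring].
- by move=> q hq; exists q, 0; split=> //; [exact: integral0 | ring].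
- move=> <-; left; exists 0, 1; split=> //; [exact: normalization1 | ring].
- move=> JN; right; have : J 1 by rewrite JN; exact: normalization1.
  move=> [q [n [hq Nn e]]]; have -> : v = v * q + n * (u * v).
    by rewrite -{1}[v]mul1r e; ring.
  by apply: QD; apply: QM.
Qed.

Section Roots.
Variables w1 w2 : K.
Hypothesis b_0 : ev b = - (ev c * (w1 + w2)).
Hypothesis a_0 : ev a = ev c * w1 * w2.

Lemma slope_roots : exists2 z, B z & (w - k w1) * (w - k w2) = phi x * z.
Proof.
have [zc Bc ec] := phi_expand c; have [zb Bb eb] := phi_expand b.
have [za Ba ea] := phi_expand a; have kc := k_neq0 c_0.
exists (- (k (ev c))^-1 * (zc * w ^+ 2 + zb * w + za)).
  apply: branchM; first by apply: branchN; apply: branch_inv; rewrite mevalC.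
  apply: branchD => //; apply: branchD; apply: branchM => //; last exact: branch_slope.
  by apply: branchX; exact: branch_slope.
apply: (mulfI kc); move: slope_eq; rewrite ec eb ea b_0 a_0.
rewrite mpolyCN rmorphN !kM mpolyCD rmorphD => e.
have -> : k (ev c) * ((w - k w1) * (w - k w2)) =
   ((k (ev c) + phi x * zc) * w ^+ 2 + (- (k (ev c) * (k w1 + k w2)) + phi x * zb) * w
   + (k (ev c) * k w1 * k w2 + phi x * za)) - phi x * (zc * w ^+ 2 + zb * w + za) by ring.
rewrite e; field; exact: kc.
Qed.

Definition is_root om := om = w1 \/ om = w2.

Lemma pointM om u v : is_root om -> B u -> branch_point om v -> branch_point om (u * v).
Proof.
move=> hom Bu; have [om' [z0 B0 e0]] : exists om', exists2 z, B z &
    (w - k om) * (w - k om') = phi x * z.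
  have [z Bz e] := slope_roots.
  by case: hom => ->; [exists w2, z | exists w1, z; rewrite // mulrC].
have [al [be [z [Bz eu]]]] := branch_expand Bu.
move=> [ga [z' [Bz' ->]]]; rewrite mulrDr; apply: pointD; last first.
  by rewrite mulrCA; apply: point_x; exact: branchM.
exists (ga * (al + be * om + be * (om' - om))), (k ga * (k be * z0 + z * (w - k om))).
split.
  apply: branchM; first exact: branch_phi.
  apply: branchD; apply: branchM => //; first exact: branch_phi.
  exact: point_branch (point_slope om).
rewrite eu kM !mpolyCD !rmorphD !kM mpolyCD rmorphD mpolyCN rmorphN.
apply/eqP; rewrite -subr_eq0; apply/eqP.
rewrite -[RHS](mulr0 (k ga * k be)) -[in RHS](subrr (phi x * z0)) -{1}e0; ring.
Qed.

Lemma point_exp om u m : is_root om -> B u -> branch_point om (u ^+ m) -> branch_point om u.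
Proof.
move=> hom Bu hm; have [al hal] := point_value om Bu.
have he : branch_point om (u ^+ m - k al ^+ m).
  rewrite subrXX mulrC; apply: pointM => //.
  elim: (index_enum _) => [|i e IH]; first by rewrite big_nil; exact: branch0.
  rewrite big_cons; apply: branchD => //.
  by apply: branchM; apply: branchX => //; exact: branch_phi.
suff al0 : al = 0 by move: hal; rewrite al0 mpolyC0 rmorph0 subr0.
have : branch_point om (k (al ^+ m)).
  have -> : k (al ^+ m) = u ^+ m + (- 1) * (u ^+ m - k al ^+ m).
    by rewrite rmorphXn /= rmorphXn /=; ring.
  by apply: pointD => //; apply: pointM => //; apply: branchN; exact: branch1.
by move/point_const/eqP; rewrite expf_eq0 => /andP [_ /eqP].
Qed.

(** * The fibre of the normalization over the origin *)

Definition point_ideal om : set L := [set n | N n /\ branch_point om n].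

Lemma point_ideal_phi om p : point_ideal om (phi p) <-> ev p = 0.
Proof.
split=> [[_ /point_phi]|e] //.
by split; [exact: normalization_phi | exact/point_phi].
Qed.

Section Fibre.
Hypothesis NB : forall n, N n -> B n.

Lemma point_ideal_ideal om : is_root om -> is_ideal phi (point_ideal om).
Proof.
move=> hom; split.
- by move=> u [].
- by rewrite -(rmorph0 phi); apply/point_ideal_phi; rewrite meval0.
- move=> u v [Nu hu] [Nv hv]; split; [exact: normalizationD | exact: pointD].
- move=> l u Nl [Nu hu]; split; first exact: normalizationM.
  by apply: pointM => //; exact: NB.
Qed.

(** Every element of the branch ring is a constant modulo the ideal of a point, so
    a larger ideal contains a nonzero constant. *)
Lemma point_ideal_fibre om : is_root om -> fibre phi (point_ideal om).
Proof.
move=> hom; have hI := point_ideal_ideal hom; have [IN I0 ID IM] := hI.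
split; last by apply/predeqP => p; exact: point_ideal_phi.
split=> //.
- move=> e; have : point_ideal om 1 by rewrite e; exact: normalization1.
  rewrite -(rmorph1 phi) => /point_ideal_phi /eqP; by rewrite meval1 oner_eq0.
- move=> J [JN J0 JD JM] sub.
  have [JI|nJI] := pselect (J `<=` point_ideal om).
    by left; apply/seteqP; split.
  right; apply/seteqP; split=> // y Ny.
  have [u [Ju nu]] : exists u, J u /\ ~ point_ideal om u.
    apply: contrapT => h; apply: nJI => u Ju; apply: contrapT => nu.
    by apply: h; exists u.
  have [al hal] := point_value om (NB (JN _ Ju)).
  have Nd : N (u - k al).
    by apply: normalizationD; [exact: JN | apply: normalizationN; exact: normalization_phi].
  have nal : al != 0.
    apply/eqP => al0; apply: nu; split; first exact: JN.
    by move: hal; rewrite al0 mpolyC0 rmorph0 subr0.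
  have Jal : J (k al).
    have -> : k al = u + phi (- 1) * (u - k al) by rewrite rmorphN rmorph1; ring.
    by apply: JD => //; apply: JM; [exact: normalization_phi | exact: sub].
  have -> : y = (y * k al^-1) * k al.
    by rewrite -mulrA -kM mulVf // mpolyC1 rmorph1 mulr1.
  by apply: JM => //; apply: normalizationM => //; exact: normalization_phi.
Qed.

(** The product of the c w - c(0) w_i lies in [Q], hence so does one of the
    factors, and it fixes the values at [Q] of all elements of the branch ring. *)
Lemma fibre_point_ideal Q : fibre phi Q -> exists2 om, is_root om & Q = point_ideal om.
Proof.
move=> [hQ /predeqP eQ]; have [[QN Q0 QD QM] _ _] := hQ.
have Qphi p : Q (phi p) <-> ev p = 0 by exact: eQ.
have Nr om : N (phi c * w - k (ev c * om)).
  apply: normalizationD; first exact: normalization_slope.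
  by apply: normalizationN; exact: normalization_phi.
have hprod : Q ((phi c * w - k (ev c * w1)) * (phi c * w - k (ev c * w2))).
  have -> : (phi c * w - k (ev c * w1)) * (phi c * w - k (ev c * w2)) =
      (phi c * w) * phi ((ev b)%:MP - b) + 1 * phi ((ev a * ev c)%:MP - a * c).
    rewrite b_0 a_0 !(rmorphD, rmorphN, rmorphM, mpolyCD, mpolyCN, mpolyCM) /=.
    apply/eqP; rewrite -subr_eq0; apply/eqP.
    by rewrite -[RHS](mulr0 (phi c)) -slope_eq; ring.
  apply: QD; apply: QM; rewrite ?Qphi.
  - exact: normalization_slope.
  - by rewrite mevalB mevalC subrr.
  - exact: normalization1.
  - by rewrite mevalB mevalM mevalC mulrC subrr.
have [om hom hr] : exists2 om, is_root om & Q (phi c * w - k (ev c * om)).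
  case: (maximal_ideal_prime hQ (Nr w1) (Nr w2) hprod) => h.
    by exists w1 => //; left.
  by exists w2 => //; right.
exists om => //.
have hc : Q (phi c * (w - k om)).
  have -> : phi c * (w - k om) = (phi c * w - k (ev c * om)) + k om * phi ((ev c)%:MP - c).
    by rewrite rmorphB kM; ring.
  apply: QD => //; apply: QM; first exact: normalization_phi.
  by apply/Qphi; rewrite mevalB mevalC subrr.
have hx z : B z -> exists2 s, ev s != 0 & Q (phi s * (phi x * z)).
  case/normalization_local => s [hs Ns]; exists s => //.
  by rewrite mulrCA mulrC; apply: QM => //; apply/Qphi.
apply/seteqP; split=> n.
- move=> hn; split; first exact: QN.
  have [al hal] := point_value om (NB (QN _ hn)).
  suff al0 : al = 0 by move: hal; rewrite al0 mpolyC0 rmorph0 subr0.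
  case: hal => be [z [Bz e]]; have [s hs hxz] := hx z Bz.
  have : Q (phi (c * s * al%:MP)).
    have -> : phi (c * s * al%:MP) = phi (c * s) * n
      + phi (- (s * be%:MP)) * (phi c * (w - k om)) + phi (- c) * (phi s * (phi x * z)).
      have -> : n = k al + (k be * (w - k om) + phi x * z) by rewrite -e; ring.
      by rewrite !(rmorphN, rmorphM); ring.
    by apply: (QD); [apply: (QD)|]; apply: (QM) => //; exact: normalization_phi.
  move/Qphi/eqP; rewrite !mevalM mevalC !mulf_eq0 (negbTE c_0) (negbTE hs).
  by move/eqP.
- move=> [Nn [be [z [Bz e]]]]; have [s hs hxz] := hx z Bz.
  have : Q (phi (c * s) * n).
    have -> : phi (c * s) * n = phi (s * be%:MP) * (phi c * (w - k om))
      + phi c * (phi s * (phi x * z)) by rewrite e !rmorphM; ring.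
    by apply: QD; apply: QM => //; exact: normalization_phi.
  case/(maximal_ideal_prime hQ (normalization_phi _) Nn) => // /Qphi /eqP.
  by rewrite mevalM mulf_eq0 (negbTE c_0) (negbTE hs).
Qed.

Lemma fibreE : fibre phi = [set point_ideal w1; point_ideal w2].
Proof.
apply/seteqP; split=> Q; first by case/fibre_point_ideal => om [] -> ->; [left|right].
by case=> ->; apply: point_ideal_fibre; [left|right].
Qed.

Lemma filtration_point_ideal m om p z : is_root om -> (exists s y,
      [/\ ev s != 0, N y, ideal_exp phi (point_ideal om) m z & phi s * phi p = y * z]) ->
  ideal_exp phi (point_ideal om) m (phi p).
Proof.
move=> hom [s [y [hs Ny hz e]]].
have hI := point_ideal_ideal hom; have [_ _ _ IM] := ideal_exp_ideal m hI.
apply: (@ideal_exp_local _ _ s) => //.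
- by move=> q /point_ideal_phi.
- exact: normalization_phi.
- by rewrite e; exact: IM.
Qed.

End Fibre.

(** * Two branches *)

Section TwoBranches.
Hypothesis w12 : w1 <> w2.

Lemma point_cap u : branch_point w1 u -> branch_point w2 u ->
  exists2 z, B z & u = phi x * z.
Proof.
move=> [be [z [Bz ->]]] [be' [z' [Bz' e]]].
have [||e1 /eqP e2] := @branch_free (be' * w2 - be * w1) (be - be') (z' - z).
- by apply: branchD => //; exact: branchN.
- rewrite !mpolyCB !rmorphB !kM.
  have -> : phi x * (z' - z) = k be' * (w - k w2) + phi x * z' - k be' * (w - k w2) - phi x * z by ring.
  by rewrite -e; ring.
exists z => //; move: e2; rewrite subr_eq0 => /eqP e2; move: e1.
rewrite -e2 -mulrBr => /eqP; rewrite mulf_eq0 subr_eq0 => /orP [/eqP->|/eqP e1].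
  by rewrite mpolyC0 rmorph0; ring.
by case: w12.
Qed.

(** The fibre x = 0 has two points for a length of two: it is reduced. *)
Lemma two_branches_normal n : N n -> B n.
Proof.
move=> Nn; have [e Be] := branch_clear n.
apply: (radical_normal phix (branch_phi x) _ (normalization_integral Nn) Be).
move=> u m z Bu Bz eu; apply: point_cap.
  by apply: (@point_exp _ _ m) => //; [left | rewrite eu; exact: point_x].
by apply: (@point_exp _ _ m) => //; [right | rewrite eu; exact: point_x].
Qed.

Lemma point_ideal_neq : point_ideal w1 <> point_ideal w2.
Proof.
have Bc : B (phi c) by exact: branch_phi.
move=> e; have : point_ideal w1 (phi c * w - phi c * k w1).
  split; last by rewrite -mulrBr; apply: pointM => //; [left | exact: point_slope].
  apply: normalizationD; first exact: normalization_slope.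
  apply: normalizationN; rewrite -rmorphM; exact: normalization_phi.
rewrite e => -[_ h].
have h2 : branch_point w2 (phi c * (w - k w2)).
  by apply: pointM => //; [right | exact: point_slope].
have : branch_point w2 (phi (c * (w2 - w1)%:MP)).
  have -> : phi (c * (w2 - w1)%:MP) = (phi c * w - phi c * k w1) + (- 1) * (phi c * (w - k w2)).
    by rewrite rmorphM mpolyCB rmorphB; ring.
  apply: pointD => //; apply: pointM => //; first by right.
  by apply: branchN; exact: branch1.
move/point_phi/eqP; rewrite mevalM mevalC mulf_eq0 (negbTE c_0) subr_eq0 => /eqP.
by move/esym.
Qed.

(** The difference of w - w1 and w - w2 is a nonzero constant, so an element killed
    by both modulo an ideal belongs to it; induction on the exponents. *)
Lemma comaximal_filtration m i j n : B n ->
    (exists2 z, B z & (w - k w1) ^+ i * n = phi x ^+ m * z) ->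
    (exists2 z, B z & (w - k w2) ^+ j * n = phi x ^+ m * z) ->
  exists2 z, B z & n = phi x ^+ m * z.
Proof.
have Bw om : B (w - k om) by exact: point_branch (point_slope om).
elim: i j n => [|i IHi] j n Bn; first by rewrite mul1r.
elim: j n Bn => [|j IHj] n Bn h1 h2; first by move: h2; rewrite mul1r.
have [] // := IHi j.+1 ((w - k w1) * n); first exact: branchM.
- by case: h1 => z Bz e; exists z => //; rewrite mulrA -exprSr.
- case: h2 => z Bz e; exists ((w - k w1) * z); first exact: branchM.
  by rewrite mulrCA e; ring.
move=> z1 Bz1 e1.
have [] // := IHj ((w - k w2) * n); first exact: branchM.
- case: h1 => z Bz e; exists ((w - k w2) * z); first exact: branchM.
  by rewrite mulrCA e; ring.
- by case: h2 => z Bz e; exists z => //; rewrite mulrA -exprSr.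
move=> z2 Bz2 e2; have nd : w2 - w1 != 0 by rewrite subr_eq0; apply/eqP => /esym.
have kd := k_neq0 nd; exists ((k (w2 - w1))^-1 * (z1 - z2)).
  apply: branchM; first by apply: branch_inv; rewrite mevalC.
  by apply: branchD => //; exact: branchN.
apply: (mulfI kd); rewrite mulrCA mulVKf // mulrBr -e1 -e2 mpolyCB rmorphB; ring.
Qed.

(** Because (w - w1) (w - w2) is a multiple of x, multiplication by w - w2 carries
    the ideal of the first point into that of x, and conversely. *)
Lemma two_branches_image m :
  scheme_image phi (ideal_exp phi (point_ideal w1) m `&` ideal_exp phi (point_ideal w2) m)
  = branch_filtration m.
Proof.
have NB := two_branches_normal.
have r1 : is_root w1 by left.
have r2 : is_root w2 by right.
have hx om : point_ideal om (phi x) by apply/point_ideal_phi.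
apply/seteqP; split=> p.
  have [z0 Bz0 ez0] := slope_roots.
  have Bw om : B (w - k om) by exact: point_branch (point_slope om).
  case=> h1 h2; have Bp : B (phi p) by exact: branch_phi.
  have [||z Bz e] := @comaximal_filtration m m m _ Bp; last by exists z.
    apply: (ideal_exp_branch (point_ideal_ideal NB r2) NB (Bw w1) _ h2) => u [_ [be [z [Bz ->]]]].
    exists (k be * z0 + (w - k w1) * z).
      by apply: branchD; apply: branchM => //; exact: branch_phi.
    by rewrite mulrDr mulrCA ez0; ring.
  apply: (ideal_exp_branch (point_ideal_ideal NB r1) NB (Bw w2) _ h1) => u [_ [be [z [Bz ->]]]].
  exists (k be * z0 + (w - k w2) * z).
    by apply: branchD; apply: branchM => //; exact: branch_phi.
  by rewrite mulrDr mulrCA [(w - k w2) * (w - _)]mulrC ez0; ring.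
move=> [z [Bz e]]; have [s [hs Ns]] := normalization_local Bz.
by split; apply: (@filtration_point_ideal NB _ _ _ (phi x ^+ m)) => //;
  exists s, (phi s * z); split=> //; rewrite ?e; [exact: ideal_exp_pow | ring
   | exact: ideal_exp_pow | ring].
Qed.

End TwoBranches.

(** * One branch *)

Section OneBranch.
Variables a1 b1 : A.
Hypothesis w1_0 : w1 = 0.
Hypothesis a_eq : a = x * a1.
Hypothesis b_eq : b = x * b1.
Hypothesis a1_0 : ev a1 != 0.

(** Here [q] is the norm of b1 w + a1 over the curve, and the second factor of the
    inverse is c times the conjugate. *)
Lemma slope_unit : exists2 z, B z & (phi b1 * w + phi a1) * z = 1.
Proof.
pose q := c * a1 ^+ 2 - a1 * b1 * b + b1 ^+ 2 * a.
have nq : ev q != 0.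
  rewrite /q a_eq b_eq !expr2 !mevalD mevalN !mevalM x_0 !(mul0r, mulr0) oppr0 !addr0.
  by rewrite !mulf_neq0.
exists ((phi q)^-1 * (phi c * phi a1 - phi b1 * phi b - phi c * phi b1 * w)).
  apply: branchM; first exact: branch_inv.
  rewrite -!rmorphM -rmorphB; apply: branchD; first exact: branch_phi.
  by apply: branchN; apply: branchM; [exact: branch_phi | exact: branch_slope].
apply: (mulfI (phi_unit nq)); rewrite mulrCA mulVKf ?phi_unit // mulr1.
rewrite /q !(rmorphD, rmorphN, rmorphM, rmorphXn) /=.
apply/eqP; rewrite -subr_eq0; apply/eqP.
rewrite -[RHS](mulr0 (- phi b1 ^+ 2)) -slope_eq; ring.
Qed.

Lemma slope_sqr_eq : phi c * w ^+ 2 = - phi x * (phi b1 * w + phi a1).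
Proof.
apply/eqP; rewrite -subr_eq0; apply/eqP; rewrite -slope_eq a_eq b_eq !rmorphM; ring.
Qed.

(** The equation of the last strict transform is c w^2 = - x (b1 w + a1), with a
    unit in brackets: w is a uniformizer and x has order two. *)
Lemma x_slope_sqr : exists2 z, B z & phi x = w ^+ 2 * z.
Proof.
have [z Bz e] := slope_unit; exists (- phi c * z).
  by apply: branchM => //; apply: branchN; exact: branch_phi.
have -> : w ^+ 2 * (- phi c * z) = - (phi c * w ^+ 2) * z by ring.
by rewrite slope_sqr_eq -[LHS]mulr1 -e; ring.
Qed.

Lemma slope_sqr_x : exists2 z, B z & w ^+ 2 = phi x * z.
Proof.
exists ((phi c)^-1 * - (phi b1 * w + phi a1)).
  apply: branchM; first exact: branch_inv.
  apply: branchN; apply: branchD; last exact: branch_phi.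
  by apply: branchM; [exact: branch_phi | exact: branch_slope].
have nc := phi_unit c_0; apply: (mulfI nc).
by rewrite slope_sqr_eq mulrCA mulVKf //; ring.
Qed.

Lemma slope_neq0 : w != 0.
Proof.
by apply/eqP => w0; have [z _ /eqP] := x_slope_sqr; rewrite w0 expr0n mul0r (negbTE phix).
Qed.

Lemma point_slopeE u : branch_point 0 u -> exists2 z, B z & u = w * z.
Proof.
have [v Bv ex] := x_slope_sqr.
move=> [be [z [Bz ->]]]; exists (k be + w * v * z).
  apply: branchD; first exact: branch_phi.
  by apply: branchM => //; apply: branchM => //; exact: branch_slope.
by rewrite mpolyC0 rmorph0 subr0 {1}ex; ring.
Qed.

(** The ideal of w is that of the only point of the exceptional fibre, hence
    radical, and inverting w inverts x. *)
Lemma one_branch_normal n : N n -> B n.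
Proof.
move=> Nn; have [e Be] := branch_clear n.
apply: (radical_normal slope_neq0 branch_slope _ (e := (2 * e)%N)
  (normalization_integral Nn)).
  move=> u m z Bu Bz eu; apply: point_slopeE; apply: (@point_exp _ _ m) => //.
    by left.
  rewrite eu mulrC; apply: pointM => //; first by left.
  by have := point_slope 0; rewrite mpolyC0 rmorph0 subr0.
have [z Bz ez] := slope_sqr_x.
rewrite exprM ez exprMn mulrAC; apply: branchM => //; exact: branchX.
Qed.

Lemma one_branch_image m :
  scheme_image phi (ideal_exp phi (point_ideal 0) (2 * m)) = branch_filtration m.
Proof.
have NB := one_branch_normal; have r0 : is_root 0 by left.
apply/seteqP; split=> p.
  move=> h; have [|z Bz] := ideal_exp_branch (y := w) (point_ideal_ideal NB r0) NB branch1 _ h.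
    by move=> u [_ /point_slopeE [z Bz ->]]; exists z; rewrite ?mul1r.
  rewrite expr1n mul1r exprM; have [z' Bz' ->] := slope_sqr_x.
  rewrite exprMn -mulrA => e; exists (z' ^+ m * z); split=> //.
  by apply: branchM => //; exact: branchX.
move=> [z [Bz e]]; have [s [hs Ns]] := normalization_local Bz.
have [v Bv ex] := x_slope_sqr; have [s' [hs' Ns']] := normalization_local Bv.
apply: (@filtration_point_ideal NB _ _ _ ((phi c * w) ^+ (2 * m))) => //.
exists ((c ^+ 2 * s') ^+ m * s), ((phi s' * v) ^+ m * (phi s * z)); split.
- rewrite mevalM mulf_neq0 // rmorphXn expf_neq0 //= mevalM mulf_neq0 //.
  by rewrite rmorphXn expf_neq0.
- by apply: normalizationM => //; exact: normalizationX.
- apply: ideal_exp_pow; split; first exact: normalization_slope.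
  apply: pointM => //; first exact: branch_phi.
  by have := point_slope 0; rewrite mpolyC0 rmorph0 subr0.
- rewrite e !(rmorphM, rmorphXn) /= ex exprM !exprMn; ring.
Qed.

End OneBranch.
End Roots.
End BranchRing.

(** * Presentations of double points *)

Section Presentation.
Variable K : closedFieldType.
Local Notation A := {mpoly K[2]}.
Local Notation X := ('X_ord0 : A).
Local Notation Y := ('X_ord_max : A).
Implicit Types (f g u v r : A) (h p q : {poly K}) (t : K).

Local Notation quadric a b c :=
  (a%:MP * X ^+ 2 + b%:MP * X * Y + c%:MP * Y ^+ 2).

Definition shear t f : A := f \mPo [tuple X + t%:MP * Y; Y].

Lemma shearK t : cancel (shear t) (shear (- t)).
Proof.
move=> f; rewrite /shear comp_comp !comp_simp comp_XE !comp_YE.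
have -> : X + (- t)%:MP * Y + t%:MP * Y = X by rewrite mpolyCN; ring.
exact: comp_id.
Qed.

Lemma order_ge_shear t k f : order_ge k f -> order_ge k (shear t f).
Proof.
apply: order_ge_comp; last exact: order_geY.
by apply: order_geD; [exact: order_geX | apply: order_geMl; exact: order_geY].
Qed.

Lemma has_mult_shear t mu f : has_mult f mu -> has_mult (shear t f) mu.
Proof.
move=> /has_multE [h1 h2]; apply/has_multE; split; first exact: order_ge_shear.
by move/(order_ge_shear (- t)); rewrite shearK.
Qed.

Lemma contact_shear t k f : contact k f -> contact k (shear t f).
Proof.
move=> [g [a [b [c [hg hb hc ->]]]]].
exists (shear t g), (shear t a), (shear t b), (shear t c).
split; [exact: has_mult_shear | exact: order_ge_shear | exact: order_ge_shear|].
by rewrite /shear !comp_simp.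
Qed.

Lemma shear_quadric t a b c r : order_ge 3 r -> exists r',
  shear t (quadric a b c + r)
    = quadric a (a * t *+ 2 + b) (a * t ^+ 2 + b * t + c) + r' /\ order_ge 3 r'.
Proof.
move=> hr; exists (shear t r); split; last exact: order_ge_shear.
rewrite /shear !comp_simp comp_XE comp_YE.
rewrite !(mpolyCD, mpolyCM, rmorphXn, mpolyCMn) /=; ring.
Qed.

Lemma exists_shear a b c : 2%:R != 0 :> K -> [|| a != 0, b != 0 | c != 0] ->
  exists t, a * t ^+ 2 + b * t + c != 0.
Proof.
move=> n2 nz; have [c0|nc] := eqVneq c 0; last first.
  by exists 0; rewrite expr0n !mulr0 !add0r.
have [e1|n1] := eqVneq (a + b) 0; last by exists 1; rewrite expr1n !mulr1 c0 addr0.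
exists (- 1); rewrite sqrrN expr1n mulr1 mulrN1 c0 addr0.
have eb : b = - a by apply/eqP; rewrite -addr_eq0 addrC e1.
move: nz; rewrite eb opprK oppr_eq0 c0 eqxx orbF orbb -mulr2n -mulr_natr => na.
by rewrite mulf_neq0.
Qed.

Variables (L : fieldType) (phi : {rmorphism A -> L}).

Lemma function_field_prime f : is_function_field phi f -> mpoly_prime f.
Proof.
move=> [kerf _] u v /(kerf _).2 /eqP.
by rewrite rmorphM mulf_eq0 => /orP [] /eqP /(kerf _).1; [left | right].
Qed.

Lemma mpoly_prime_shear t f : mpoly_prime f -> mpoly_prime (shear t f).
Proof.
have shearM s u v : shear s (u * v) = shear s u * shear s v by exact: comp_mpolyM.
have shearK' : cancel (shear (- t)) (shear t).
  by move=> u; rewrite -{1}[t]opprK; exact: shearK.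
move=> pf u v [w e]; have : divides f (shear (- t) u * shear (- t) v).
  by exists (shear (- t) w); rewrite -shearM e shearM shearK.
by case/pf => -[y ey]; [left|right]; exists (shear t y); rewrite -shearM -ey shearK'.
Qed.

(** A shear brings y^2 into the tangent cone. There the maximal contact is given by
    a graph, and the presentation that it provides is sheared back. The number of
    blow-ups needs no shear, since the order of contact is the same before and
    after. *)
Lemma double_point_presentation f : 2%:R != 0 :> K ->
    is_function_field phi f -> has_mult f 2 ->
  exists x g a b c n,
    [/\ resolved_by n f, has_mult g 1, normal_presentation phi f x g a b c n
      & (exists w1 w2, [/\ w1 <> w2, b.@[fun=> 0] = - (c.@[fun=> 0] * (w1 + w2))
                        & a.@[fun=> 0] = c.@[fun=> 0] * w1 * w2]) \/
        (exists a1 b1, [/\ a = x * a1, b = x * b1 & a1.@[fun=> 0] != 0])].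
Proof.
move=> n2 ff hf; have [h2 h3] := proj1 (has_multE _ _) hf.
have [a0 [b0 [c0 [r [ef hr]]]]] := quadratic_part h2.
have nz : [|| a0 != 0, b0 != 0 | c0 != 0] by apply: (quadric_neq0 hr); rewrite -ef.
have [t nt] := exists_shear n2 nz.
have [r' [es hr']] := shear_quadric t a0 b0 c0 hr; rewrite -ef in es.
have ps := mpoly_prime_shear (t := t) (function_field_prime ff).
have [n hn] := contact_bounded ps es hr' nt n2.
have [k [hc hk]] : exists k, contact k.+1 f /\ ~ contact k.+2 f.
  by apply: maximal_contact => //; exists n => hc; apply: hn; exact: contact_shear.
have hsc := contact_shear t hc.
have hsk : ~ contact k.+2 (shear t f).
  by move/(contact_shear (- t)); rewrite shearK.
have [h [a [b [c [h0 e nc typ]]]]] := maximal_normal_form es hr' nt hsc hsk.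
pose sh : A -> A := shear (- t).
have shD u v : sh (u + v) = sh u + sh v by exact: comp_mpolyD.
have shM u v : sh (u * v) = sh u * sh v by exact: comp_mpolyM.
have shN u : sh (- u) = - sh u by exact: comp_mpolyN.
have shX u m : sh (u ^+ m) = sh u ^+ m by exact: comp_mpolyXn.
have shC s : sh s%:MP = s%:MP by exact: comp_mpoly_const.
have sh_ev u : (sh u).@[fun=> 0] = u.@[fun=> 0].
  have [s [du hs]] := const_term u; move: (u.@[_]) du => m0 ->.
  rewrite shD shC mevalD mevalC.
  by rewrite (proj1 (order_ge1E _) (order_ge_shear (- t) hs)) addr0.
have shK : cancel (shear t) sh := shearK t.
have shK' : cancel sh (shear t).
  by move=> u; rewrite /sh -{1}[t]opprK; exact: shearK.
have sh0 : sh 0 = 0 by exact: comp_mpoly0.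
pose G := Y - xpoly h.
have hG : has_mult (sh G) 1 by apply: has_mult_shear; exact: graph_has_mult.
clearbody sh.
have [h1 eh] := poly_factorX h0.
have eY : Y = G + X * xpoly h1 by rewrite /G eh xpolyM xpolyX; ring.
exists (sh X), (sh G), (sh (xpoly a)), (sh (xpoly b)), (sh c), k.+1; split.
- exact: contact_resolved_by.
- exact: hG.
- constructor=> //.
  + by rewrite sh_ev mevalXU.
  + by rewrite sh_ev /G mevalB meval_xpoly mevalXU h0 subrr.
  + move=> p p0; have [u [v [e1 _ _]]] : order_ge 1 (shear t p).
      by apply: order_ge_shear; apply/order_ge1E.
    exists (sh (u + xpoly h1 * v)), (sh v).
    by rewrite -[p]shK e1 -!shM -shD {1}eY; congr sh; ring.
  + move=> p q e1.
    have {}e1 : X ^+ k.+1 * shear t p + G * shear t q = 0.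
      apply: (can_inj shK'); rewrite shD !shM shX !shK e1.
      by rewrite sh0.
    have [q1 eq1] := on_graph_remainder h (shear t p).
    have p0 : on_graph h (shear t p) = 0.
      have := congr1 (on_graph h) e1.
      rewrite !on_graphE on_graph_xpoly subrr mul0r addr0 ?polyC0.
      by move/eqP; rewrite mulf_eq0 expf_eq0 /= polyX_eq0 /= => /eqP.
    rewrite p0 xpoly0 add0r in eq1.
    have nG : G != 0.
      apply/eqP => G0; have := graph_has_mult h0; rewrite -/G G0.
      by move=> /has_multE [_]; apply; exact: order_ge_0.
    have {}e1 : shear t q = - (X ^+ k.+1 * q1).
      apply: (mulfI nG); apply/eqP; rewrite -subr_eq0 -e1 eq1 -/G; apply/eqP; ring.
    rewrite -[p]shK -[q]shK !sh_ev eq1 e1 mevalN !mevalM exprS mevalM mevalXU.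
    by rewrite mevalB meval_xpoly mevalXU h0; split; ring.
  + have e' := congr1 sh e; rewrite shK in e'; rewrite [LHS]e' -/G.
    generalize G (2 * k.+1)%N k.+1 => G0 n3 n4.
    by rewrite !shD !shM !shX; ring.
  + by rewrite sh_ev.
  + apply/eqP => /(proj1 ff _).1 [w ew].
    have hX : order_ge 2 X.
      rewrite -[X]shK' ew; apply: order_ge_shear; exact: order_geMl.
    have := @order_ge_monomial K 1 ord0 1; rewrite expr1 mul1r => /(_ hX) /eqP.
    by rewrite oner_eq0.
  + move=> p np.
    have nd : ~ divides (shear t f) (shear t p).
      case=> w ew; move/eqP: np; apply; apply/(proj1 ff _).2; exists (sh w).
      by rewrite -[p]shK ew shM shK.
    have sf := deriv_neq0_size (quadric_deriv_neq0 es hr' nt n2).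
    have [D [u [v [nD eD]]]] := elimination ps sf nd.
    (* Split off the power of x that divides the eliminant. *)
    have [e0 [D1]] := multiplicity_XsubC D 0; rewrite nD subr0 /= => nD1 eDX.
    exists e0, (sh (xpoly D1)), (sh v); split.
      by rewrite sh_ev meval_xpoly.
    have phif : phi f = 0 by apply/(proj1 ff _).2; exists 1; rewrite mul1r.
    have -> : sh X ^+ e0 * sh (xpoly D1) = sh u * f + sh v * p.
      rewrite -shX -shM -[Z in _ = _ * Z + _]shK -[Z in _ = _ + _ * Z]shK -!shM -shD -eD.
      by rewrite eDX [D1 * _]mulrC xpolyXnM.
    by rewrite rmorphD [phi (sh u * f)]rmorphM /= phif mulr0 add0r.
- case: typ => [[w1 [w2 [nw eb ea]]]|[a1 [b1 [ea eb na]]]].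
    by left; exists w1, w2; rewrite !sh_ev !meval_xpoly.
  right; exists (sh (xpoly a1)), (sh (xpoly b1)).
  by rewrite ea eb !xpolyM !xpolyX !shM sh_ev meval_xpoly; split=> //; apply/eqP.
Qed.

End Presentation.

(** * Classification of double points *)

Lemma double_point_classification (K : closedFieldType) (L : fieldType)
    (phi : {rmorphism {mpoly K[2]} -> L}) (f : {mpoly K[2]}) :
    2%:R != 0 :> K -> is_function_field phi f -> has_mult f 2 ->
  exists2 r, resolved_by r f &
    (exists Q1 Q2, [/\ Q1 <> Q2, fibre phi = [set Q1; Q2]
       & forall k, curvilinear_in f
           (scheme_image phi (ideal_exp phi Q1 k `&` ideal_exp phi Q2 k)) k <->
           (k <= r)%N]) \/
    (exists2 Q, fibre phi = [set Q]
       & forall k, curvilinear_in f (scheme_image phi (ideal_exp phi Q (2 * k))) k <->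
           (k <= r)%N).
Proof.
move=> n2 ff hf.
have [x [g [a [b [c [r [rf hg pres typ]]]]]]] := double_point_presentation n2 ff hf.
exists r => //; case: typ => [[w1 [w2 [w12 b0 a0]]]|[a1 [b1 [ea eb na]]]].
  left; exists (point_ideal phi x g r w1), (point_ideal phi x g r w2); split.
  - exact: point_ideal_neq pres _ _ b0 a0 w12.
  - exact: fibreE pres _ _ b0 a0 (two_branches_normal pres b0 a0 w12).
  - move=> k; rewrite (two_branches_image pres b0 a0 w12).
    exact: curvilinear_filtration pres _ hg.
have b0 : b.@[fun=> 0] = - (c.@[fun=> 0] * (0 + 0)).
  by rewrite eb mevalM (np_x0 pres) mul0r addr0 mulr0 oppr0.
have a0 : a.@[fun=> 0] = c.@[fun=> 0] * 0 * 0 by rewrite ea mevalM (np_x0 pres) mul0r mulr0.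
right; exists (point_ideal phi x g r 0).
  rewrite (fibreE pres b0 a0); first by rewrite setUid.
  exact: one_branch_normal pres _ _ b0 a0 _ _ erefl ea eb na.
move=> k; rewrite (one_branch_image pres b0 a0 erefl ea eb na).
exact: curvilinear_filtration pres _ hg.
Qed.

Lemma set2_inj T (x y z t : T) : [set x; y] = [set z; t] -> x <> y ->
  (x = z /\ y = t) \/ (x = t /\ y = z).
Proof.
move=> e nxy.
have hx : [set z; t] x by rewrite -e; left.
have hy : [set z; t] y by rewrite -e; right.
case: hx hy => hx [] hy; rewrite /= in hx hy.
- by case: nxy; rewrite hx hy.
- by left.
- by right.
- by case: nxy; rewrite hx hy.
Qed.

Lemma set2_eq1 T (x y z : T) : [set x; y] = [set z] -> x = y.
Proof.
move=> e; have hx : [set z] x by rewrite -e; left.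
have hy : [set z] y by rewrite -e; right.
by rewrite hx hy.
Qed.

Theorem theorem2p1 (R : realType) (d : nat) (F : {mpoly R[i][3]})
    (p : 'I_3 -> R[i]) (j : 'I_3) (f : {mpoly R[i][2]})
    (L : fieldType) (phi : {rmorphism {mpoly R[i][2]} -> L}) (m : nat)
    (homF : F \is d.-homog) (irrF : mpoly_irreducible F)
    (pj_neq0 : p j != 0) (f_def : f = affine_chart F p j)
    (Lf : is_function_field phi f)
    (double_point : has_mult f 2) (m_ge1 : (1 <= m)%N) :
  (A_singularity phi f (2 * m - 1) <->
     exists Q1 Q2 : set L,
       [/\ Q1 <> Q2 /\ fibre phi = [set Q1; Q2],
           curvilinear_in f
             (scheme_image phi (ideal_exp phi Q1 m `&` ideal_exp phi Q2 m)) m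
         & forall k : nat,
             curvilinear_in f
               (scheme_image phi (ideal_exp phi Q1 k `&` ideal_exp phi Q2 k)) k ->
             (k <= m)%N])
  /\
  (A_singularity phi f (2 * m) <->
     exists Q : set L,
       [/\ fibre phi = [set Q],
           curvilinear_in f (scheme_image phi (ideal_exp phi Q (2 * m))) m
         & forall k : nat,
             curvilinear_in f (scheme_image phi (ideal_exp phi Q (2 * k))) k ->
             (k <= m)%N]).
Proof.
have n2 : 2%:R != 0 :> R[i] by rewrite Num.Theory.pnatr_eq0.
have [r rf typ] := double_point_classification n2 Lf double_point.
have number s : A_singularity phi f s -> exists eps : bool,
    s = (2 * r - eps)%N /\
    if eps then exists Q1 Q2, Q1 <> Q2 /\ fibre phi = [set Q1; Q2]
    else exists Q, fibre phi = [set Q].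
  move=> [_ [r' [eps [es rf' h]]]]; exists eps.
  by rewrite -(resolved_by_inj rf' rf).
split; split.
- case/number => // -[] [es h]; last by lia.
  have em : m = r by lia.
  case: typ => [[Q1 [Q2 [nQ fQ hc]]]|[Q fQ _]].
    exists Q1, Q2; split=> //; first by apply/hc; rewrite em.
    by move=> k /hc; rewrite em.
  by case: h => Q1 [Q2 [nQ]]; rewrite fQ => e; case: nQ; exact: set2_eq1 (esym e).
- move=> [Q1 [Q2 [[nQ fQ] hm hmax]]].
  case: typ => [[Q3 [Q4 [nQ' fQ' hc]]]|[Q fQ' _]]; last first.
    by case: nQ; apply: (@set2_eq1 _ _ _ Q); rewrite -fQ.
  have {}hc k : curvilinear_in f
      (scheme_image phi (ideal_exp phi Q1 k `&` ideal_exp phi Q2 k)) k <-> (k <= r)%N.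
    rewrite fQ' in fQ; have [[<- <-]|[<- <-]] := set2_inj fQ nQ'; first exact: hc.
    by rewrite setIC; exact: hc.
  have em : m = r.
    by apply/eqP; rewrite eqn_leq; apply/andP; split; [apply/hc | apply/hmax/hc].
  split=> //; exists r, true; split=> //; first by rewrite em.
  by exists Q1, Q2.
- case/number => // -[] [es h]; first by lia.
  have em : m = r by lia.
  case: typ => [[Q1 [Q2 [nQ fQ _]]]|[Q fQ hc]].
    by case: h => Q; rewrite fQ => e; case: nQ; exact: set2_eq1 e.
  exists Q; split=> //; first by apply/hc; rewrite em.
  by move=> k /hc; rewrite em.
- move=> [Q [fQ hm hmax]].
  case: typ => [[Q1 [Q2 [nQ fQ' _]]]|[Q' fQ' hc]].
    by case: nQ; apply: (@set2_eq1 _ _ _ Q); rewrite -fQ'.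
  have eQ : Q = Q'.
    have : [set Q] Q by [].
    by rewrite -fQ fQ'.
  rewrite -eQ in hc.
  have em : m = r.
    by apply/eqP; rewrite eqn_leq; apply/andP; split; [apply/hc | apply/hmax/hc].
  split=> //; exists r, false; split=> //; first by rewrite em subn0.
  by exists Q.
Qed.
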